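(* Let $-\infty<r_3<r_2<r_1<\infty$ and let $\nu$ be the uniform probability measure on $\{r_3,r_2,r_1\}$. For ballistic annihilation on $\mathbb{R}$ with speed law $\nu$ and with either unit or exponential spacings between consecutive initial particle positions, a particle with speed $r_2$ survives with positive probability.
   Context: (Two-sided) ballistic annihilation with speed law $\nu$: at time $0$ particles are placed at the points $\cdots<x_{-1}<x_0=0<x_1<\cdots$ of $\mathbb{R}$. With unit spacings, $x_k=k$ for all $k\in\mathbb{Z}$. With exponential spacings, the gaps $x_{k+1}-x_k$, $k\in\mathbb{Z}$, are i.i.d. exponential random variables with mean $1$ (i.e. a unit intensity Poisson process seen from one of its particles). Each particle is independently (also of the positions) assigned a velocity from the law $\nu$ on $\mathbb{R}$ (called its speed; it may be negative or zero) and moves at constant velocity. When two or more particles meet, all of them are annihilated (removed). A particle survives if it is never annihilated. ''A particle with speed $r$ survives with positive probability'' means that, conditional on the particle started at $x_0=0$ having speed $r$, the probability that it is never annihilated is positive. *)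

(* Defs.v *)
From HB Require Import structures.
From mathcomp Require Import all_boot all_order all_algebra.
From mathcomp Require Import finmap.
From mathcomp Require Import all_classical all_reals all_analysis.
Set Implicit Arguments.
Unset Strict Implicit.
Unset Printing Implicit Defensive.
Import Order.TTheory GRing.Theory Num.Theory.
Import numFieldNormedType.Exports.
Local Open Scope classical_set_scope.
Local Open Scope ring_scope.

Section dynamics.
Context {R : realType}.
Implicit Types (x v : int -> R) (tau : int -> \bar R).

Definition position x v (i : int) (t : R) : R := x i + t * v i.

(* [tau i] is the time at which particle [i] is removed, [+oo] if it never is.
   Particle [i] is still present on arrival at time [t] iff [t <= tau i].
   A removed particle meets another particle still present, and particles that
   meet while still present are all removed at once, so that collisions of
   three or more particles are covered. *)
Definition annihilation_times x v tau : Prop :=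
  [/\ forall i, (0 <= tau i)%E,
      forall i t, tau i = t%:E ->
        exists j : int, [/\ j != i, position x v j t = position x v i t
                    & (t%:E <= tau j)%E]
    & forall (i j : int) t, i != j -> 0 <= t ->
        position x v i t = position x v j t ->
        (t%:E <= tau i)%E -> (t%:E <= tau j)%E ->
        tau i = t%:E /\ tau j = t%:E].

(* For a locally finite configuration with bounded velocities [tau] is unique,
   see [annihilation_times_unique] below. *)
Definition survives x v (i : int) : Prop :=
  exists2 tau, annihilation_times x v tau & tau i = +oo%E.

Lemma annihilation_times_unique x v (V : R) tau tau' :
  (forall M, finite_set [set i | `|x i| <= M]) -> (forall i, `|v i| <= V) ->
  annihilation_times x v tau -> annihilation_times x v tau' -> tau =1 tau'.
Proof.
move=> fin_x leV.
suff H : forall M n tau tau' j s,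
    annihilation_times x v tau -> annihilation_times x v tau' ->
    (#|` [fset k in fset_set [set i | (`|x i| <= M)%R] |
           (mine (tau k) (tau' k) <= s%:E)%E]%fset| < n)%N ->
    tau j = s%:E -> (s%:E < tau' j)%E ->
    `|position x v j s| + V * s <= M -> False.
  have lt_false t t' i : annihilation_times x v t ->
      annihilation_times x v t' -> (t i < t' i)%E -> False.
    move=> dyn dyn' lt_i; have [ge0 _ _] := dyn.
    case E : (t i) (ge0 i) => [s| |] // _; last by rewrite E ltNge leey in lt_i.
    by rewrite E in lt_i; apply: (H _ _ _ _ i s dyn dyn' (leqnn _) E lt_i (lexx _)).
  by move=> dyn dyn' i; case: (ltgtP (tau i) (tau' i)) => // /lt_false; case.
move=> M; elim=> [|n IHn] {}tau {}tau' j s dyn dyn' //.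
rewrite ltnS => leA tauj tau'j coneM.
have [ge0 hit meet] := dyn; have [ge0' _ meet'] := dyn'.
have s0 : 0 <= s by rewrite -lee_fin -tauj.
have xjM : `|x j| <= M.
  have -> : x j = position x v j s - s * v j by rewrite addrK.
  apply: le_trans (ler_normB _ _) (le_trans _ coneM).
  by rewrite lerD2l normrM ger0_norm// mulrC ler_wpM2r.
have [k [kj posk tauk]] := hit _ _ tauj.
have Ek : tau k = s%:E by have [] := meet k j s kj s0 posk tauk; rewrite ?tauj.
have lt_k : (tau' k < s%:E)%E.
  rewrite ltNge; apply/negP => le_k.
  have [_ tau'jE] := meet' k j s kj s0 posk le_k (ltW tau'j).
  by rewrite tau'jE ltxx in tau'j.
case Ek' : (tau' k) (ge0' k) lt_k => [u| |] //=.
rewrite lee_fin lte_fin => u0 us.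
apply: (IHn tau' tau k u dyn' dyn _ Ek').
- apply: leq_trans leA; apply: fproper_ltn_card.
  rewrite fproperEneq andbC; apply/andP; split.
    apply/fsubsetP => i; rewrite !inE /= => /andP[-> /le_trans]; rewrite minC; apply.
    by rewrite lee_fin ltW.
  apply/eqP => /fsetP /(_ j).
  rewrite !inE /= in_fset_set// mem_set//= tauj [in RHS]ge_min lexx /=.
  apply/negP.
  rewrite -ltNge lt_min lte_fin us andbT.
  by rewrite (lt_trans _ tau'j) ?lte_fin.
- by rewrite Ek lte_fin.
- have su0 : 0 <= s - u by rewrite subr_ge0 ltW.
  apply: le_trans coneM; rewrite -posk.
  have -> : position x v k u = position x v k s - (s - u) * v k.
    by rewrite /position mulrBl opprB addrA addrAC addrK.
  rewrite (le_trans (lerD (ler_normB _ _) (lexx _)))// -addrA lerD2l.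
  rewrite normrM (ger0_norm su0) -lerBrDr -mulrBr mulrC.
  by rewrite ler_wpM2r.
Qed.

End dynamics.

Section probability.
Context {R : realType} {d : measure_display} {T : measurableType d}.
Variable P : probability T R.

Definition mutually_independent (I : choiceType) (X : I -> T -> R) :=
  forall (J : {fset I}) (B : I -> set R), (forall i, measurable (B i)) ->
    P (\bigcap_(i in [set` J]) (X i @^-1` B i)) =
    (\prod_(i <- J) P (X i @^-1` B i))%E.

Definition has_law (X : T -> R) (m : set R -> \bar R) : Prop :=
  forall B, measurable B -> P (X @^-1` B) = m B.

(* Uniform law on the entries of [s]; meant for [s] without repetition. *)
Definition uniform_on (s : seq R) (B : set R) : \bar R :=
  (((size s)%:R^-1)%:E * \sum_(a <- s) \d_a B)%E.

Definition cond_prob (A B : set T) : R := fine (P (A `&` B)) / fine (P B).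

Implicit Types x v : int -> {RV P >-> R}.

Definition gap x (k : int) (w : T) : R := x (k + 1) w - x k w.

(* Strict monotonicity of the positions is built in for unit spacings and holds
   almost surely for exponential ones. *)
Definition unit_spacings x : Prop := forall k w, x k w = k%:~R.

Definition exponential_spacings x : Prop :=
  (forall w, x 0 w = 0) /\ forall k, has_law (gap x k) (exponential_prob 1).

Definition gaps_and_velocities x v (i : int + int) : T -> R :=
  match i with inl k => gap x k | inr k => v k end.

End probability.

(* Main.v *)
Require Import Defs.
From HB Require Import structures.
From mathcomp Require Import all_boot all_order all_algebra.
From mathcomp Require Import finmap.
From mathcomp Require Import all_classical all_reals all_analysis.
From mathcomp Require Import measurable_realfun.
From mathcomp Require Import zify ring lra.
Set Implicit Arguments.
Unset Strict Implicit.
Unset Printing Implicit Defensive.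
Import Order.TTheory GRing.Theory Num.Theory.
Import numFieldNormedType.Exports.
Local Open Scope classical_set_scope.
Local Open Scope ring_scope.

(* Call particles of speed r1, r2, r3 right-moving, static and left-moving: only
   relative speeds matter. Let q_n be the probability that a static particle at 0,
   alone with the particles 1, ..., n, is hit. Suppose that it is hit, and look at
   particle 1. Either it is left-moving. Or it is static or right-moving, and then
   there is a first k such that 1 and k annihilate each other in the system reduced
   to 1, ..., k; all of 1, ..., k are gone by then, so that a static particle at x_k
   would be hit by the later ones, which has probability at most q_n. If 1 is static,
   the existence of k is itself an event of probability at most q_n. Therefore
     q_(n+1) <= (1 + q_n + q_n^2) / 3,
   a critical recursion, whose only fixed point is 1. It is improved by the
   initial speeds r1 (r1 r3)^M r2 r3 with suitable gaps: there particle 1 would meet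
   the static particle k = 2M + 2, but k is hit by k + 1 before that, so that 1 has
   to meet some later particle, after which a fresh hit is still needed. On this
   event of probability c > 0 the bound 1 is replaced by q_n, whence
     q_(n+1) <= (1 + q_n + q_n^2) / 3 - c (1 - q_n)
   for large n, and q_n stays away from 1. By reflection the same holds on the
   left-hand side, and the two sides are independent. *)

(** * Dynamics restricted to a set of particles *)

(** In terms of d = 1 - q_n the critical recursion says that the next d is at least d - d^2 / 3,
    which does not prevent d from tending to 0. A gain linear in d, however small its factor c,
    outweighs d^2 / 3 as soon as d <= 3c; hence one event of positive probability is enough. Unit
    gaps leave no freedom in the distances, so the pattern delays particle 1 by the M pairs (r1,
    r3), whose members destroy each other. Particle 1 needs a time of at least (2M + 1) / (r1 - r2)
    to reach the static particle k, and k + 1 needs at most 1 / (r2 - r3); M is chosen so that the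
    second is smaller. On the pattern the system reduced to 1, ..., k does remove 1 and k, and k + 1
    does hit a static particle at x_k. The crude bound therefore counts the pattern in full,
    although in the true system 0 is still exposed to a fresh attack. The product bounds rest on a
    clean cut at k: the stop is decided by the gaps before x_k and the speeds up to that of k, the
    later hit by the gaps and speeds after it. This is why k is replaced by a static particle
    whatever its own speed. *)

Ltac int_lia := try (match goal with K : realType |- _ => clear dependent K end); lia.

Lemma count_lt (T : eqType) (a b : pred T) (s : seq T) k :
  subpred a b -> k \in s -> b k -> ~~ a k -> (count a s < count b s)%N.
Proof.
move=> ab + bk nak; elim: s => //= y s IH; rewrite inE => /orP[/eqP <-|/IH lt].
  by rewrite bk (negbTE nak) add0n ltnS sub_count.
by rewrite -addnS leq_add //; case: (a y) (ab y) => // ->.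
Qed.

Section restricted_dynamics.
Context {R : realType}.
Implicit Types (x v : int -> R) (tau : int -> \bar R) (J : pred int).

(** Times outside [J] are left free, so that one [tau] can serve for several sets of particles, as
    in [dyn_restrict]. *)
Definition dyn x v J tau : Prop :=
  [/\ forall i, J i -> (0 <= tau i)%E,
      forall i t, J i -> tau i = t%:E ->
        exists j, [/\ J j, j != i, position x v j t = position x v i t
                    & (t%:E <= tau j)%E]
    & forall i j t, J i -> J j -> i != j -> 0 <= t ->
        position x v i t = position x v j t ->
        (t%:E <= tau i)%E -> (t%:E <= tau j)%E ->
        tau i = t%:E /\ tau j = t%:E].

Lemma dynT x v tau : dyn x v predT tau <-> annihilation_times x v tau.
Proof.
split=> -[H1 H2 H3]; split.
- by move=> i; exact: H1.
- by move=> i t /(H2 _ _ isT)[j [_ ? ? ?]]; exists j.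
- by move=> i j t; exact: H3.
- by move=> i _; exact: H1.
- by move=> i t _ /H2[j [? ? ?]]; exists j.
- by move=> i j t _ _; exact: H3.
Qed.

Lemma dyn_reindex x v x' v' J tau (f g : int -> int) :
  cancel f g -> cancel g f ->
  (forall i j t, position x' v' i t = position x' v' j t <->
    position x v (f i) t = position x v (f j) t) ->
  dyn x v J tau -> dyn x' v' (fun i => J (f i)) (fun i => tau (f i)).
Proof.
move=> fK gK E [H1 H2 H3]; split=> [i|i t Ji /(H2 _ _ Ji)[j [Jj ji Ej tj]]|].
- exact: H1.
- exists (g j); rewrite gK; split=> //; last by apply/E; rewrite gK.
  by apply: contra_neq ji => <-; rewrite gK.
- move=> i j t Ji Jj ij t0 /E; apply: H3 => //.
  by rewrite (inj_eq (can_inj fK)).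
Qed.

Lemma dyn_congr x v x' v' J J' tau tau' :
  J =1 J' -> (forall i, J i -> [/\ x i = x' i, v i = v' i & tau i = tau' i]) ->
  dyn x v J tau -> dyn x' v' J' tau'.
Proof.
move=> JJ' E [H1 H2 H3].
have Ep i t : J i -> position x' v' i t = position x v i t.
  by rewrite /position => /E[-> -> _].
split=> [i|i t|i j t]; rewrite -!JJ' => Ji.
- by case: (E _ Ji) => _ _ <-; exact: H1.
- case: (E _ Ji) => _ _ <- /(H2 _ _ Ji)[j [Jj ji ej tj]]; exists j.
  by rewrite -JJ' !Ep//; case: (E _ Jj) => _ _ <-.
- move=> Jj; rewrite !Ep//; case: (E _ Ji) => _ _ <-; case: (E _ Jj) => _ _ <-.
  exact: H3.
Qed.

(* The hypotheses on [C] say that it is a union of backward light cones. *)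
Lemma dyn_agree x v J J' (F : seq int) (C : int -> R -> Prop) tau tau' :
  (forall i s, C i s -> J i = J' i) ->
  (forall i s, C i s -> J i -> i \in F) ->
  (forall i k s, C i s -> position x v k s = position x v i s -> C k s) ->
  (forall i s u, C i s -> 0 <= u <= s -> C i u) ->
  dyn x v J tau -> dyn x v J' tau' ->
  forall i s, J i -> C i s -> tau i = s%:E -> tau' i = s%:E.
Proof.
move=> CJ CF Cpos Cdown dy dy'.
(* If [i] is removed at [s] in one system and later in the other, its partner [k], also removed at
   [s] in the first, is gone in the second at some [u < s]. The systems then exchange roles, with
   fewer particles of [F] removed before [u] than before [s]. *)
have H : forall n J J' tau tau' i s,
    (forall i s, C i s -> J i = J' i) ->
    (forall i s, C i s -> J i -> i \in F) ->
    dyn x v J tau -> dyn x v J' tau' ->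
    (count (fun k => (mine (tau k) (tau' k) < s%:E)%E) F < n)%N ->
    J i -> C i s -> tau i = s%:E -> (s%:E < tau' i)%E -> False.
  elim=> [//|n IH] {dy dy' CJ CF}J1 J2 t1 t2 i s CJ CF d1 d2.
  rewrite ltnS => le_n Ji Cis Ei lti.
  have [ge1 hit1 meet1] := d1; have [ge2 _ meet2] := d2.
  have s0 : 0 <= s by rewrite -lee_fin -Ei; exact: ge1.
  have [k [Jk ki posk lek]] := hit1 _ _ Ji Ei.
  have Cks : C k s by exact: Cpos posk.
  have [Ek _] : t1 k = s%:E /\ t1 i = s%:E by apply: meet1; rewrite // ?Ei.
  have J2k : J2 k by rewrite -(CJ _ _ Cks).
  have J2i : J2 i by rewrite -(CJ _ _ Cis).
  have ltk : (t2 k < s%:E)%E.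
    rewrite ltNge; apply/negP => le2.
    have [_ E2] := meet2 _ _ _ J2k J2i ki s0 posk le2 (ltW lti).
    by rewrite E2 ltxx in lti.
  case Ek2 : (t2 k) (ge2 _ J2k) ltk => [u| |] // ; rewrite lee_fin lte_fin => u0 us.
  have Cku : C k u by apply: Cdown Cks _; rewrite u0 ltW.
  apply: (IH J2 J1 t2 t1 k u _ _ d2 d1 _ J2k Cku Ek2).
  - by move=> ? ? /CJ.
  - by move=> j t Cjt; rewrite -(CJ _ _ Cjt); exact: CF Cjt.
  - apply: leq_trans le_n.
    apply: (@count_lt _ _ _ _ k) => [j| | |].
    + by rewrite minC => /lt_trans; apply; rewrite lte_fin.
    + exact: CF Cks Jk.
    + by rewrite Ek Ek2 gt_min !lte_fin us orbT.
    + by rewrite Ek Ek2 -leNgt le_min !lee_fin lexx ltW.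
  - by rewrite Ek lte_fin.
move=> i s Ji Cis Ei.
case: (ltgtP (tau' i) s%:E) => // lt.
  have J'i : J' i by rewrite -(CJ _ _ Cis).
  have [ge0 _ _] := dy'.
  case Eu : (tau' i) (ge0 _ J'i) (lt) => [u| |] //; rewrite lee_fin lte_fin => u0 us.
  exfalso; apply: (H _ J' J tau' tau i u _ _ dy' dy (ltnSn _) J'i _ Eu).
  - by move=> ? ? /CJ.
  - by move=> j t Cjt; rewrite -(CJ _ _ Cjt); exact: CF Cjt.
  - by apply: Cdown Cis _; rewrite u0 ltW.
  - by rewrite Ei lte_fin.
by exfalso; exact: (H _ J J' tau tau' i s CJ CF dy dy' (ltnSn _) Ji Cis Ei lt).
Qed.

(** With finitely many particles the whole of space-time can play the part of the light cones. *)
Lemma dyn_uniq x v (s : seq int) tau tau' :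
  dyn x v (mem s) tau -> dyn x v (mem s) tau' -> {in s, tau =1 tau'}.
Proof.
move=> d d' i si.
have H t t' u : dyn x v (mem s) t -> dyn x v (mem s) t' -> t i = u%:E -> t' i = u%:E.
  move=> dt dt'; apply: (@dyn_agree x v _ _ s (fun _ _ => True) t t' _ _ _ _ dt dt') => //.
case E : (tau i) => [u| |]; first by rewrite (H _ _ _ d d' E).
  case E' : (tau' i) => [u| |] //; first by rewrite -E (H _ _ _ d' d E').
  by have [/(_ i si)] := d'; rewrite E'.
by have [/(_ i si)] := d; rewrite E.
Qed.

Section ordered.
Variables (x v : int -> R).
Hypothesis x_incr : forall i j, i < j -> x i < x j.

(** Two particles in the wrong order at [t] would have crossed at some [s < t], both present, and
    would have been removed at [s]. *)
Lemma dyn_order J tau i j t : dyn x v J tau -> J i -> J j -> i < j -> 0 <= t ->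
  (t%:E <= tau i)%E -> (t%:E <= tau j)%E -> position x v i t <= position x v j t.
Proof.
move=> [_ _ meet] Ji Jj ij t0 ti tj; rewrite leNgt; apply/negP.
rewrite /position => lt_ji; have lt_x := x_incr ij.
have vv : 0 < v i - v j.
  rewrite ltNge; apply/negP => vv.
  have : t * (v i - v j) <= 0 by rewrite mulr_ge0_le0.
  by rewrite mulrBr; lra.
set s := (x j - x i) / (v i - v j).
have Es : s * (v i - v j) = x j - x i by rewrite divfK ?gt_eqF.
have s0 : 0 <= s by rewrite divr_ge0 ?ltW// subr_gt0.
have st : s < t.
  by rewrite -(ltr_pM2r vv) Es mulrBr; lra.
have le_s k : (t%:E <= tau k)%E -> (s%:E <= tau k)%E.
  by apply: le_trans; rewrite lee_fin ltW.
have ne : i != j by rewrite lt_eqF.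
have pe : position x v i s = position x v j s.
  by move: Es; rewrite /position mulrBr; lra.
have [E _] := meet i j s Ji Jj ne s0 pe (le_s _ ti) (le_s _ tj).
by rewrite E lee_fin leNgt st in ti.
Qed.

(** Until they collide, [a] and [b] act as walls: by order preservation nothing from outside gets
    between them, and an inner particle outliving [t] would be squeezed into the collision point and
    removed there. *)
Lemma dyn_restrict J tau a b t : dyn x v J tau -> a < b -> J a -> J b ->
  tau a = t%:E -> tau b = t%:E -> position x v a t = position x v b t ->
  dyn x v (fun i => J i && (a <= i <= b)) tau
  /\ forall i, J i -> a <= i <= b -> (tau i <= t%:E)%E.
Proof.
move=> d ab Ja Jb Ea Eb pab; have [ge0 hit meet] := d.
have t0 : 0 <= t by rewrite -lee_fin -Ea; exact: ge0.
have le_t i : J i -> a <= i <= b -> (tau i <= t%:E)%E.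
  move=> Ji /andP[ai ib]; rewrite leNgt; apply/negP => lt_i.
  have [E|nai] := eqVneq a i; first by rewrite -E Ea ltxx in lt_i.
  have [E|nib] := eqVneq i b; first by rewrite E Eb ltxx in lt_i.
  have lt_ai : a < i by rewrite lt_neqAle nai.
  have lt_ib : i < b by rewrite lt_neqAle nib.
  have p1 : position x v a t <= position x v i t.
    by apply: (dyn_order d) => //; rewrite ?Ea// ltW.
  have p2 : position x v i t <= position x v b t.
    by apply: (dyn_order d) => //; rewrite ?Eb// ltW.
  have pe : position x v a t = position x v i t.
    by apply/eqP; rewrite eq_le p1 pab p2.
  have [] := meet a i t Ja Ji nai t0 pe _ (ltW lt_i); first by rewrite Ea.
  by move=> _ E; rewrite E ltxx in lt_i.
split; last exact: le_t.
split=> [i /andP[Ji _]|i u /andP[Ji iab] Ei|i j u /andP[Ji _] /andP[Jj _]].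
- exact: ge0.
- have u0 : 0 <= u by rewrite -lee_fin -Ei; exact: ge0.
  have [Ia|nia] := eqVneq i a.
    exists b; rewrite Jb (ltW ab) lexx; split=> //; first by rewrite Ia gt_eqF.
      by move: Ei; rewrite Ia Ea => -[<-].
    by rewrite -Ei Ia Ea Eb.
  have [Ib|nib] := eqVneq i b.
    exists a; rewrite Ja (ltW ab) lexx; split=> //; first by rewrite Ib lt_eqF.
      by move: Ei; rewrite Ib Eb => -[<-].
    by rewrite -Ei Ib Ea Eb.
  case/andP: (iab) => ai ib.
  have lt_ai : a < i by rewrite lt_neqAle eq_sym nia.
  have lt_ib : i < b by rewrite lt_neqAle nib.
  have := le_t _ Ji iab; rewrite Ei lee_fin => ut.
  have uEa : (u%:E <= tau a)%E by rewrite Ea lee_fin.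
  have uEb : (u%:E <= tau b)%E by rewrite Eb lee_fin.
  have uEi : (u%:E <= tau i)%E by rewrite Ei.
  have pai := dyn_order d Ja Ji lt_ai u0 uEa uEi.
  have pib := dyn_order d Ji Jb lt_ib u0 uEi uEb.
  have [j [Jj ji pj uj]] := hit _ _ Ji Ei.
  (* A partner beyond a wall forces the wall itself to be at the same place, so the wall can stand
     in for it. *)
  have [ja|aj] := ltP j a.
    exists a; rewrite Ja lexx (ltW ab); split=> //; first by rewrite lt_eqF.
    apply/eqP; rewrite eq_le pai -pj; apply: (dyn_order d) => //.
  have [jb|bj] := leP j b; first by exists j; rewrite Jj aj jb.
  exists b; rewrite Jb lexx (ltW ab); split=> //; first by rewrite gt_eqF.
  apply/eqP; rewrite eq_le pib -pj andbT; apply: (dyn_order d) => //.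
- exact: meet.
Qed.

Lemma collision_uniq i j t u : i != j -> position x v i t = position x v j t ->
  position x v i u = position x v j u -> t = u.
Proof.
move=> ij; rewrite /position => E1 E2.
have E : (t - u) * (v i - v j) = 0 by rewrite mulrBl !mulrBr; lra.
move/eqP: E; rewrite mulf_eq0 !subr_eq0 => /orP[/eqP//|/eqP vv].
exfalso; rewrite vv in E1; move/addIr: E1 => xx.
by case: (ltgtP i j) ij => // /x_incr; rewrite xx ltxx.
Qed.

End ordered.
End restricted_dynamics.

Section bigmin.
Context {R : realType} {I : eqType}.
Implicit Types (f : I -> \bar R) (s : seq I).

Lemma bigmine_le f s i : i \in s -> (\big[mine/+oo]_(j <- s) f j <= f i)%E.
Proof.
elim: s => // j s IH; rewrite inE big_cons ge_min => /orP[/eqP ->|/IH ->].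
  by rewrite lexx.
by rewrite orbT.
Qed.

Lemma bigmine_attained f s : s != [::] ->
  exists2 i, i \in s & \big[mine/+oo%E]_(j <- s) f j = f i.
Proof.
elim: s => // j [|k s] IH _.
  by exists j; rewrite ?mem_head// big_seq1.
have [i si Ei] := IH isT; rewrite big_cons.
case: (leP (f j) (\big[mine/+oo%E]_(l <- k :: s) f l)) => _.
  by exists j; rewrite ?mem_head.
by exists i; rewrite // inE si orbT.
Qed.
End bigmin.

(** * Computing the dynamics of finitely many particles *)

Section algorithm.
Context {R : realType}.
Implicit Types (x v : int -> R) (s : seq int).

(** Positions enter through [x j - x i] alone, so whatever is computed from it is a function of gaps
    and speeds. Equal speeds are excluded explicitly because division by 0 returns 0. *)
Definition meeting_time x v i j : \bar R :=
  if (v i != v j) && (0 <= (x j - x i) / (v i - v j))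
  then ((x j - x i) / (v i - v j))%:E else +oo%E.

Definition first_meeting x v s : \bar R :=
  \big[mine/+oo%E]_(i <- s) \big[mine/+oo%E]_(j <- s) meeting_time x v i j.

Definition meets_first x v s i :=
  has (fun j => meeting_time x v i j == first_meeting x v s) s.

(* When no two particles of [s] ever meet, [first_meeting x v s] is [+oo] and
   all of them are discarded at once with removal time [+oo]. *)
Fixpoint removal_time (n : nat) s x v (i : int) : \bar R :=
  if n is n'.+1 then
    if meets_first x v s i then first_meeting x v s
    else removal_time n' [seq j <- s | ~~ meets_first x v s j] x v i
  else +oo%E.

Lemma meeting_timeP x v i j t : meeting_time x v i j = t%:E ->
  [/\ i != j, 0 <= t & position x v i t = position x v j t].
Proof.
rewrite /meeting_time; case: ifP => // /andP[vv t0] [<-]; split=> //.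
  by apply: contra_neq vv => ->.
have : (x j - x i) / (v i - v j) * (v i - v j) = x j - x i.
  by rewrite divfK// subr_eq0.
by rewrite /position mulrBr; lra.
Qed.

Lemma first_meeting_le x v s i j : i \in s -> j \in s ->
  (first_meeting x v s <= meeting_time x v i j)%E.
Proof.
move=> si sj; apply: le_trans (bigmine_le _ si) _; exact: bigmine_le.
Qed.

Lemma first_meeting_attained x v s : s != [::] -> has (meets_first x v s) s.
Proof.
move=> s0; have [i si Ei] := bigmine_attained
  (fun i => \big[mine/+oo%E]_(j <- s) meeting_time x v i j) s0.
have [j sj Ej] := bigmine_attained (meeting_time x v i) s0.
apply/hasP; exists i => //; apply/hasP; exists j => //.
by rewrite /first_meeting Ei Ej.
Qed.

Section increasing.
Variables (x v : int -> R).
Hypothesis x_incr : forall i j, i < j -> x i < x j.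

Lemma meeting_time_eq i j t : i != j -> 0 <= t ->
  position x v i t = position x v j t -> meeting_time x v i j = t%:E.
Proof.
move=> ij t0 pe.
have vv : v i != v j.
  apply/eqP => vv; move: pe; rewrite /position vv => /addIr xx.
  by case: (ltgtP i j) ij => // /x_incr; rewrite xx ltxx.
have E : (x j - x i) / (v i - v j) = t.
  apply: (mulIf (x := v i - v j)); first by rewrite subr_eq0.
  by rewrite divfK ?subr_eq0//; move: pe; rewrite /position mulrBr; lra.
by rewrite /meeting_time vv E t0.
Qed.

(** The earliest meeting in the list is a true collision, as nobody has been removed before it. The
    minimum over a nonempty list is attained, so each round discards a particle and [size s] rounds
    suffice. *)
Lemma removal_time_dyn n s : (size s <= n)%N ->
  dyn x v (mem s) (removal_time n s x v).
Proof.
elim: n s => [|n IH] s le_n.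
  have -> : s = [::] by case: s le_n.
  by split.
have [s0|s0] := eqVneq s [::]; first by rewrite s0; split.
set s' := [seq j <- s | ~~ meets_first x v s j].
set m := first_meeting x v s.
have le_s' : (size s' <= n)%N.
  rewrite -ltnS; apply: leq_trans le_n; rewrite size_filter.
  rewrite -(count_predC (meets_first x v s) s) -[X in (X < _)%N]add0n.
  by rewrite ltn_add2r -has_count first_meeting_attained.
have [ge0 hit meet] := IH _ le_s'.
have m0 : (0 <= m)%E.
  have /hasP[i si /hasP[j sj /eqP E]] := first_meeting_attained x v s0.
  rewrite /m -E; case Et : meeting_time => [t| |] //.
    by have [_ t0 _] := meeting_timeP Et.
  by move: Et; rewrite /meeting_time; case: ifP.
have ms' i : i \in s -> ~~ meets_first x v s i -> i \in s'.
  by move=> si ni; rewrite mem_filter ni.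
split=> [i si|i t si|i j t si sj ij t0 pe] /=; rewrite -/m -/s'.
- by case: ifP => // /negbT ni; apply: ge0; exact: ms'.
- case: ifP => [/hasP[j sj /eqP Ej] Em|/negbT ni Et].
    move: Ej; rewrite -/m Em => Ej; have [ij t0 pe] := meeting_timeP Ej.
    have mj : meets_first x v s j.
      apply/hasP; exists i => //.
      by apply/eqP; rewrite -/m Em; apply: meeting_time_eq; rewrite // eq_sym.
    by exists j; rewrite eq_sym ij pe /= mj.
  have [j [s'j ji pe le_t]] := hit i t (ms' _ si ni) Et.
  move: s'j; rewrite inE mem_filter => /andP[nj sj].
  by exists j; rewrite (negbTE nj).
- have in_m : meeting_time x v i j == m -> meets_first x v s i /\ meets_first x v s j.
    move=> /eqP E; split; apply/hasP; [exists j|exists i]; rewrite //; apply/eqP => //.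
    rewrite -/m -E (meeting_time_eq ij t0 pe); apply: meeting_time_eq => //.
    by rewrite eq_sym.
  have mt : meeting_time x v i j = t%:E by exact: meeting_time_eq.
  have le_m : (m <= t%:E)%E by rewrite -mt first_meeting_le.
  have [Em|] := eqVneq m t%:E.
    by have [-> ->] := in_m (introT eqP (etrans mt (esym Em))).
  move=> ne; have lt_m : (m < t%:E)%E by rewrite lt_neqAle ne.
  case: ifP => [_ /le_lt_trans/(_ lt_m)|/negbT ni]; first by rewrite ltxx.
  case: ifP => [_ _ /le_lt_trans/(_ lt_m)|/negbT nj]; first by rewrite ltxx.
  by apply: meet => //; exact: ms'.
Qed.

End increasing.
End algorithm.

(** * Collisions within a window of consecutive particles *)

Definition window (a : int) (n : nat) : seq int := [seq a + k%:Z | k <- iota 0 n.+1].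

Lemma mem_window a n i : (i \in window a n) = (a <= i <= a + n%:Z).
Proof.
apply/mapP/idP => [[k]|/andP[ai ia]].
  by rewrite mem_iota => /andP[_ kn] ->; int_lia.
exists `|i - a|%N; last by int_lia.
by rewrite mem_iota; int_lia.
Qed.

Lemma size_window a n : size (window a n) = n.+1.
Proof. by rewrite size_map size_iota. Qed.

Section meeting.
Context {R : realType}.
Implicit Types (x v : int -> R).

Definition window_time x v a n := removal_time n.+1 (window a n) x v.

(** Phrased through computed times, it is a boolean whose measurability can be followed step by
    step; [meetP] then frees it from the algorithm. *)
Definition meet x v (a : int) (n : nat) : bool :=
  let b := a + n%:Z in
  [&& meeting_time x v a b != +oo%E,
      window_time x v a n a == meeting_time x v a b
    & window_time x v a n b == meeting_time x v a b].

Definition set_speed (c : R) v (a : int) : int -> R :=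
  fun i => if i == a then c else v i.

(** Overwriting the speed of [a] makes the event a function of the gaps from [a] on and of the
    speeds after [a], hence independent of everything up to and including the speed of [a]. *)
Definition hit (c : R) x v a n := meet x (set_speed c v a) a n.

Section increasing.
Variable x : int -> R.
Hypothesis x_incr : forall i j, i < j -> x i < x j.

Lemma window_time_dyn v a n :
  dyn x v (fun i => a <= i <= a + n%:Z) (window_time x v a n).
Proof.
have sz : (size (window a n) <= n.+1)%N by rewrite size_window.
by apply: dyn_congr (removal_time_dyn v x_incr sz) => // i; rewrite -mem_window.
Qed.

Lemma window_dyn_uniq v a n tau tau' :
  dyn x v (fun i => a <= i <= a + n%:Z) tau ->
  dyn x v (fun i => a <= i <= a + n%:Z) tau' ->
  forall i, a <= i <= a + n%:Z -> tau i = tau' i.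
Proof.
have E t : dyn x v (fun i => a <= i <= a + n%:Z) t -> dyn x v (mem (window a n)) t.
  by apply: dyn_congr => // i; rewrite /= mem_window.
by move=> /E d /E d' i ia; apply: (dyn_uniq d d'); rewrite mem_window.
Qed.

Lemma meet_gt0 v a n : meet x v a n -> (0 < n)%N.
Proof.
case: n => // /and3P[]; rewrite addr0; case E: meeting_time => [t| |] //.
  by have [] := meeting_timeP E; rewrite eqxx.
by move: E; rewrite /meeting_time; case: ifP.
Qed.

Lemma meetP v a n : meet x v a n <-> exists tau t,
  [/\ dyn x v (fun i => a <= i <= a + n%:Z) tau, (0 < n)%N, tau a = t%:E,
      tau (a + n%:Z) = t%:E & position x v a t = position x v (a + n%:Z) t].
Proof.
split=> [m|[tau [t [d n0 Ea Eb pe]]]].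
  have n0 := meet_gt0 m; case/and3P: m => noo /eqP Ea /eqP Eb.
  case E : (meeting_time x v a (a + n%:Z)) noo Ea Eb => [t| |] // _ Ea Eb; last first.
    by move: E; rewrite /meeting_time; case: ifP.
  by exists (window_time x v a n), t; have [] := meeting_timeP E; split=> //;
    exact: window_time_dyn.
have t0 : 0 <= t by have [/(_ a) + _ _] := d; rewrite Ea lee_fin; apply; int_lia.
have mt : meeting_time x v a (a + n%:Z) = t%:E.
  by apply: meeting_time_eq => //; int_lia.
rewrite /meet mt /= -!(window_dyn_uniq d (window_time_dyn v a n)); try int_lia.
by rewrite Ea Eb !eqxx.
Qed.

(** The two colliding particles shield the window that they span, so the collision already takes
    place in that window alone. *)
Lemma meet_of_dyn v J tau a b t : dyn x v J tau -> a < b ->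
  (forall i, a <= i <= b -> J i) -> tau a = t%:E -> tau b = t%:E ->
  position x v a t = position x v b t -> meet x v a `|b - a|%N.
Proof.
move=> d ab sJ Ea Eb pe; apply/meetP; exists tau, t.
have -> : a + `|b - a|%N%:Z = b by int_lia.
split=> //; last by int_lia.
have Ja : J a by apply: sJ; int_lia.
have Jb : J b by apply: sJ; int_lia.
have [d' _] := dyn_restrict x_incr d ab Ja Jb Ea Eb pe.
apply: dyn_congr d' => // i; case: (boolP (a <= i <= b)) => [/sJ ->//|_].
by rewrite andbF.
Qed.

Lemma meet_congr v v' a n : (forall i, a <= i <= a + n%:Z -> v i = v' i) ->
  meet x v a n = meet x v' a n.
Proof.
have H w w' : (forall i, a <= i <= a + n%:Z -> w i = w' i) ->
    meet x w a n -> meet x w' a n.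
  move=> E /meetP[tau [t [d n0 Ea Eb pe]]]; apply/meetP; exists tau, t.
  by rewrite /position -!E; try int_lia; split=> //; apply: dyn_congr d => // i /E.
by move=> E; apply/idP/idP; apply: H => // i /E.
Qed.

(** * What a hit of particle 0 implies for particle 1 *)

Section three_speeds.
Variables (r1 r2 r3 : R).
Hypotheses (hr32 : r3 < r2) (hr21 : r2 < r1).

Local Notation hit := (hit r2).
Local Notation speeds v := (forall i : int, v i \in [:: r3; r2; r1]).

Ltac speed_lra := move: (hr32) (hr21) => ? ?; lra.

Lemma speedsP v i : speeds v -> [\/ v i = r3, v i = r2 | v i = r1].
Proof.
by move/(_ i); rewrite !inE => /or3P[]/eqP; [constructor 1|constructor 2|constructor 3].
Qed.

Lemma speeds_ge v i : speeds v -> r3 <= v i.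
Proof. by move/speedsP => /(_ i)[]->; speed_lra. Qed.

Lemma speeds_le v i : speeds v -> v i <= r1.
Proof. by move/speedsP => /(_ i)[]->; speed_lra. Qed.

Lemma speeds_set v : speeds v -> speeds (set_speed r2 v 0).
Proof. by move=> vin i; rewrite /set_speed; case: ifP => // _; rewrite !inE eqxx orbT. Qed.

(** Particle 1 starts ahead of 0 and is not slower, so it separates 0 from [m] and must vanish
    before they meet. Its partner is neither 0, which stays behind it, nor [m], which lives until
    [t]. *)
Lemma first_collides v m tau t : speeds v -> v 0 = r2 -> v 1 != r3 ->
  dyn x v (fun i => 0 <= i <= m%:Z) tau -> (0 < m)%N ->
  tau 0 = t%:E -> tau m%:Z = t%:E -> position x v 0 t = position x v m%:Z t ->
  exists j u, [/\ 1 < j < m%:Z, tau 1 = u%:E, tau j = u%:E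
    & position x v 1 u = position x v j u].
Proof.
move=> vin v0 v1 d m0 E0 Em pe; have [ge0 hit meet] := d.
have v12 : r2 <= v 1 by case: (speedsP 1 vin) v1 => ->; rewrite ?eqxx //; speed_lra.
have t0 : 0 <= t by rewrite -lee_fin -E0; apply: ge0; int_lia.
have x01 := x_incr (ltr01 : (0 : int) < 1).
have lt01 s : 0 <= s -> position x v 0 s < position x v 1 s.
  by move=> s0; rewrite /position v0 ltr_leD// ler_wpM2l.
have m1 : (1 < m)%N.
  rewrite ltn_neqAle m0 andbT; apply/eqP => m1.
  by move: pe (lt01 _ t0); rewrite -m1 => ->; rewrite ltxx.
have lt_t : (tau 1%R < t%:E)%E.
  rewrite ltNge; apply/negP => le_t.
  suff : position x v 1 t <= position x v m%:Z t by rewrite -pe leNgt lt01.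
  by apply: (dyn_order x_incr d); rewrite ?Em //; int_lia.
have := ge0 1; case E1 : (tau 1) lt_t => [u| |] // lt_t u0; last first.
  by have := u0 ltac:(int_lia).
have {}u0 : 0 <= u by rewrite -lee_fin; apply: u0; int_lia.
have [j [Jj j1 pj le_j]] := hit 1 u ltac:(int_lia) E1.
have ne1 : 1 != j by rewrite eq_sym.
have [_ Ej] := meet 1 j u ltac:(int_lia) Jj ne1 u0 (esym pj) ltac:(by rewrite E1) le_j.
exists j, u; split=> //.
have j0 : j != 0.
  by apply/eqP => j0; move: pj (lt01 _ u0); rewrite j0 => ->; rewrite ltxx.
have jm : j != m%:Z.
  by apply/eqP => jm; move: lt_t; rewrite -Em -jm Ej ltxx.
by int_lia.
Qed.

Lemma hitP v m : hit x v 0 m <-> exists tau t,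
  [/\ dyn x (set_speed r2 v 0) (fun i => 0 <= i <= m%:Z) tau, (0 < m)%N,
      tau 0 = t%:E, tau m%:Z = t%:E &
      position x (set_speed r2 v 0) 0 t = position x (set_speed r2 v 0) m%:Z t].
Proof. by rewrite -[m%:Z in X in _ <-> X]add0r; exact: meetP. Qed.

Lemma hit_first_meet v m : speeds v -> v 1 != r3 -> hit x v 0 m ->
  exists j, [/\ (0 < j)%N, (1 + j < m)%N & meet x v 1 j].
Proof.
move=> vin v1 /hitP[tau [t [d m0 E0 Em pe]]].
have [j [u [jm E1 Ej pj]]] := first_collides (speeds_set vin) erefl v1 d m0 E0 Em pe.
exists `|j - 1|%N; split; try int_lia.
rewrite (@meet_congr _ (set_speed r2 v 0)).
  by apply: (meet_of_dyn d) E1 Ej pj => [|i]; int_lia.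
by move=> i i1; rewrite /set_speed ifF//; int_lia.
Qed.

(* If nothing beyond [1 + k] ever reached the position of [1 + k], the windows
   [[1, 1 + k]] and [[1 + k, m]] would not interact and [0] would survive. *)
Lemma hit_after_meet v m k : speeds v -> v 1 != r3 -> hit x v 0 m ->
  (1 + k < m)%N -> meet x v 1 k -> exists l, (l <= m - 1 - k)%N /\ hit x v (1 + k%:Z) l.
Proof.
move=> vin v1 /hitP[tau [t [d m0 E0 Em pe]]] km mk.
have k0 := meet_gt0 mk.
have v12 : r2 <= v 1 by case: (speedsP 1 vin) v1 => ->; rewrite ?eqxx //; speed_lra.
have x01 := x_incr (ltr01 : (0 : int) < 1).
move/meetP : mk => [sig [s [ds _ Es1 Esk ps]]].
set b := 1 + k%:Z in ds Esk ps *.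
have s0 : 0 <= s by have [/(_ 1) + _ _] := ds; rewrite Es1 lee_fin; apply; int_lia.
have b1 : 1 < b by rewrite /b; int_lia.
have [ge_s hit_s meet_s] := ds.
have [_ le_s] := dyn_restrict x_incr ds b1 ltac:(int_lia) ltac:(int_lia) Es1 Esk ps.
(* A particle of speed [r1] ahead of 1 is never caught by it. *)
have vb : v b <= r2.
  case: (speedsP b vin) => vb; rewrite vb; try speed_lra.
  have : s * v 1 <= s * v b by rewrite ler_wpM2l// vb speeds_le.
  by move: ps (x_incr b1); rewrite /position; lra.
set w := set_speed r2 v b.
have wb : w b = r2 by rewrite /w /set_speed eqxx.
have wE i : i != b -> w i = v i by rewrite /w /set_speed => /negbTE ->.
set n := (m - 1 - k)%N; set rho := window_time x w b n.
have dr : dyn x w (fun i => b <= i <= b + n%:Z) rho := window_time_dyn w b n.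
have [ge_r hit_r meet_r] := dr.
have bn : b + n%:Z = m%:Z by rewrite /b /n; int_lia.
case Erb : (rho b) => [u| |]; last 1 first.
- by have /(_ ltac:(int_lia)) := ge_r b; rewrite Erb.
- have [j [Jj jb pj le_j]] := hit_r b u ltac:(int_lia) Erb.
  have u0 : 0 <= u by have := ge_r b; rewrite Erb lee_fin; apply; int_lia.
  have bj : b != j by rewrite eq_sym.
  have [_ Ej] := meet_r b j u ltac:(int_lia) Jj bj u0 (esym pj) ltac:(by rewrite Erb) le_j.
  exists `|j - b|%N; split; first int_lia.
  by apply: (meet_of_dyn dr) Erb Ej (esym pj) => [|i]; int_lia.
(* Remaining case: a static [b] survives the attack from its right. Glue the two windows, letting 0
   live forever and giving [b] its time from the left window. The moving point [x b + u * r2]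
   separates them: the left window stays weakly behind it since [v b <= r2], and the right one
   strictly ahead since [rho b = +oo]. So [g] is a dynamics in which 0 survives, against
   uniqueness. *)
pose g i : \bar R := if i == 0 then +oo%E else if i <= b then sig i else rho i.
have g0 : g 0 = +oo%E by rewrite /g eqxx.
have gs i : 1 <= i <= b -> g i = sig i.
  by move=> ib; rewrite /g ifF ?ifT //; int_lia.
have gr i : b < i -> g i = rho i.
  by move=> ib; rewrite /g ifF ?ifF //; int_lia.
set v' := set_speed r2 v 0.
have p0 t' : position x v' 0 t' = x 0 + t' * r2 by rewrite /position /v' /set_speed eqxx.
have pE i t' : i != 0 -> position x v' i t' = position x v i t'.
  by rewrite /position /v' /set_speed => /negbTE ->.
have pw i t' : i != b -> position x w i t' = position x v i t'.
  by rewrite /position => /wE ->.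
have sep1 i u : 1 <= i <= b -> 0 <= u -> (u%:E <= sig i)%E ->
    position x v' 0 u < position x v i u <= x b + u * r2.
  move=> ib u0 ui.
  have us : u <= s by rewrite -lee_fin (le_trans ui)// le_s //; int_lia.
  have u1 : (u%:E <= sig 1%R)%E by rewrite Es1 lee_fin.
  have ub : (u%:E <= sig b)%E by rewrite Esk lee_fin.
  apply/andP; split.
    apply: (@lt_le_trans _ _ (position x v 1 u)).
      by rewrite p0 /position ltr_leD// ler_wpM2l.
    have [<-//|i1] := eqVneq 1 i.
    by apply: (dyn_order x_incr ds); rewrite //; int_lia.
  apply: (@le_trans _ _ (position x v b u)); last first.
    by rewrite /position lerD2l ler_wpM2l.
  have [->//|ib'] := eqVneq i b.
  by apply: (dyn_order x_incr ds); rewrite //; int_lia.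
have sep2 i u : b < i <= m%:Z -> 0 <= u -> (u%:E <= rho i)%E ->
    x b + u * r2 < position x v i u.
  move=> ib u0 ui.
  have -> : x b + u * r2 = position x w b u by rewrite /position wb.
  have bi : b != i by int_lia.
  rewrite -pw; last by rewrite eq_sym.
  rewrite lt_neqAle; apply/andP; split.
    apply/eqP => pe'; have := meet_r b i u ltac:(int_lia) ltac:(int_lia) bi u0 pe'.
    by rewrite Erb leey => /(_ isT ui)[].
  by apply: (dyn_order x_incr dr); rewrite ?Erb ?leey//; int_lia.
have xb0 u : position x v' 0 u < x b + u * r2.
  by rewrite p0 ltrD2r x_incr// (lt_trans _ b1).
have dg : dyn x v' (fun i => 0 <= i <= 0 + m%:Z) g.
  have g_ge0 i : 0 <= i <= 0 + m%:Z -> (0 <= g i)%E.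
    move=> im; have [->|i0] := eqVneq i 0; first by rewrite g0 leey.
    have [ib|bi] := leP i b; first by rewrite gs; [apply: ge_s|]; int_lia.
    by rewrite gr//; apply: ge_r; int_lia.
  have cross i j u : 0 <= i <= 0 + m%:Z -> 0 <= j <= 0 + m%:Z -> i < j -> 0 <= u ->
      position x v' i u = position x v' j u -> (u%:E <= g i)%E -> (u%:E <= g j)%E ->
      g i = u%:E /\ g j = u%:E.
    move=> im jm ij u0 + gi gj; have j0 : j != 0 by int_lia.
    rewrite (pE j)//; have [i0|i0] := eqVneq i 0.
      rewrite i0; have [jb|bj] := leP j b.
        have /andP[] := sep1 j u ltac:(int_lia) u0 ltac:(by rewrite -gs; [|int_lia]).
        by move=> lt _ E; rewrite E ltxx in lt.
      have := sep2 j u ltac:(int_lia) u0 ltac:(by rewrite -gr).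
      by move=> /(lt_trans (xb0 u)) + E; rewrite E ltxx.
    rewrite (pE i)//; have [ib|bi] := leP i b; last first.
      rewrite !gr; [|int_lia|int_lia]; rewrite gr in gi; [|int_lia]; rewrite gr in gj; [|int_lia].
      rewrite -!pw; [|int_lia|int_lia] => pe'.
      by apply: meet_r => //; int_lia.
    have [jb|bj] := leP j b.
      rewrite !gs; [|int_lia|int_lia]; rewrite gs in gi; [|int_lia]; rewrite gs in gj; [|int_lia] => pe'.
      by apply: meet_s => //; int_lia.
    have /andP[_ le] := sep1 i u ltac:(int_lia) u0 ltac:(by rewrite -gs; [|int_lia]).
    have := sep2 j u ltac:(int_lia) u0 ltac:(by rewrite -gr).
    by move=> /(le_lt_trans le) + E; rewrite E ltxx.
  split=> // [i u im|i j u im jm ij u0 pe' gi gj].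
    have [->|i0] := eqVneq i 0; first by rewrite g0.
    have [ib|bi] := leP i b.
      rewrite gs; last int_lia.
      move=> /hit_s[|j [Jj ji pj le_j]]; first int_lia.
      have j1 : j != 0 by int_lia.
      by exists j; rewrite gs ?pE//; split=> //; int_lia.
    rewrite gr// => Ei; have [|j [Jj ji pj le_j]] := hit_r _ _ _ Ei; first int_lia.
    have u0 : 0 <= u by have := ge_r i; rewrite Ei lee_fin; apply; int_lia.
    have jb : j != b.
      apply/eqP => jb; have ne : i != b by int_lia.
      have := meet_r i b u ltac:(int_lia) ltac:(int_lia) ne u0.
      by rewrite Ei Erb leey lexx -jb pj => /(_ erefl isT isT)[].
    exists j; rewrite gr; last int_lia.
    have j0 : j != 0 by int_lia.
    have ib : i != b by int_lia.
    by move: pj; rewrite !pw ?pE//; split=> //; int_lia.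
  have [lt|lt|E] := ltgtP i j.
  - exact: cross.
  - by have [] := cross j i u jm im lt u0 (esym pe') gj gi.
  - by rewrite E eqxx in ij.
have d' : dyn x v' (fun i => 0 <= i <= 0 + m%:Z) tau.
  by apply: dyn_congr d => // i; rewrite add0r.
by have /(_ ltac:(int_lia)) := window_dyn_uniq d' dg (i := 0); rewrite E0 g0.
Qed.

End three_speeds.
End increasing.
End meeting.

(** * The initial pattern that improves the critical recursion *)

Section pattern.
Context {R : realType}.
Variables (r1 r2 r3 : R).
Hypotheses (hr32 : r3 < r2) (hr21 : r2 < r1).
Ltac speed_lra := move: (hr32) (hr21) => ? ?; lra.
Local Notation speeds v := (forall i : int, v i \in [:: r3; r2; r1]).

(* The speeds r1, (r1, r3)^M, r2, r3 of particles 1, ..., 2M + 3. *)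
Definition pattern_speed (M j : nat) : R :=
  if j == 1%N then r1 else if j == (2 * M + 2)%N then r2
  else if odd j then r3 else r1.

Definition speed_pattern M (v : int -> R) :=
  forall j : nat, (0 < j <= 2 * M + 3)%N -> v j%:Z = pattern_speed M j.

(** The constant gap 1 satisfies both bounds, which is why they are not strict. *)
Definition gap_pattern M (x : int -> R) :=
  (forall j : nat, (0 < j <= 2 * M + 1)%N -> 1 <= x (j%:Z + 1) - x j%:Z) /\
  x (2 * M + 3)%:Z - x (2 * M + 2)%:Z <= 1.

Variable x : int -> R.
Hypothesis x_incr : forall i j, i < j -> x i < x j.

(** [r3] is the least speed, so nothing to the right of [i + 1] is ever met by [i + 1], nor by [i]
    before [u]. A particle from the left cannot reach [i + 1] without passing [i], so only a meeting
    with [i] has to be excluded. *)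
Lemma adjacent_collide v J tau i u : (forall j, r3 <= v j) -> v (i + 1) = r3 ->
  dyn x v J tau -> J i -> J (i + 1) -> 0 <= u ->
  position x v i u = position x v (i + 1) u ->
  (forall j s, J j -> j < i -> 0 <= s < u -> (s%:E <= tau j)%E ->
    position x v j s != position x v i s) ->
  tau i = u%:E /\ tau (i + 1) = u%:E.
Proof.
move=> vge vi1 d Ji Ji1 u0 pe left_free; have [ge0 hit meet] := d.
have ne : i != i + 1 by int_lia.
suff [ui ui1] : (u%:E <= tau i)%E /\ (u%:E <= tau (i + 1)%R)%E by apply: meet.
have lt_u s : s < u -> position x v i s < position x v (i + 1) s.
  move=> su; move: pe; rewrite /position => pe.
  have xx : x i < x (i + 1) by apply: x_incr; int_lia.
  have vv : 0 < v i - v (i + 1).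
    rewrite ltNge; apply/negP => vv.
    have : u * (v i - v (i + 1)) <= 0 by rewrite mulr_ge0_le0.
    by rewrite mulrBr; lra.
  have : s * (v i - v (i + 1)) < u * (v i - v (i + 1)) by rewrite ltr_pM2r.
  by rewrite !mulrBr; lra.
have right_free j s : J j -> i < j -> 0 <= s < u ->
    position x v i s != position x v j s.
  move=> Jj ij /andP[s0 su].
  rewrite lt_eqF// (lt_le_trans (lt_u _ su))//.
  have [->//|ne'] := eqVneq j (i + 1).
  have xx : x (i + 1) < x j by apply: x_incr; int_lia.
  by rewrite /position vi1 lerD ?(ltW xx)// ler_wpM2l.
have Hi s : tau i = s%:E -> s < u -> False.
  move=> Ei su; have s0 : 0 <= s by rewrite -lee_fin -Ei; exact: ge0.
  have [j [Jj ji pj le_j]] := hit _ _ Ji Ei.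
  have [ij|ij] := ltP i j.
    by have := right_free j s Jj ij; rewrite s0 su pj eqxx => /(_ isT).
  have lt : j < i by rewrite lt_neqAle ji.
  by have := left_free j s Jj lt; rewrite s0 su pj eqxx => /(_ isT le_j).
have ui : (u%:E <= tau i)%E.
  case Ei : (tau i) (ge0 _ Ji) => [s| |] // _; last exact: leey.
  by rewrite lee_fin leNgt; apply/negP; exact: Hi.
split=> //.
case Es : (tau (i + 1)) (ge0 _ Ji1) => [s| |] // s0; last exact: leey.
rewrite lee_fin in s0 *; rewrite leNgt; apply/negP => su.
have [j [Jj ji pj le_j]] := hit _ _ Ji1 Es.
have [ij|ij] := ltP (i + 1) j.
  have xx : x (i + 1) < x j by apply: x_incr.
  have : position x v (i + 1) s < position x v j s.
    by rewrite /position vi1 ltr_leD// ler_wpM2l.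
  by rewrite pj ltxx.
have {}ji : j <= i by move: ji; int_lia.
have : position x v j s <= position x v i s.
  have [->//|ne'] := eqVneq j i.
  apply: (dyn_order x_incr d) => //; first by int_lia.
  by apply: le_trans ui; rewrite lee_fin ltW.
by rewrite pj leNgt lt_u.
Qed.

(** [r1] is the greatest speed, so nothing catches [i] from behind. *)
Lemma fast_slow_collide v J tau i : speeds v -> v i = r1 -> v (i + 1) = r3 ->
  dyn x v J tau -> J i -> J (i + 1) -> exists u,
  [/\ tau i = u%:E, tau (i + 1) = u%:E & position x v i u = position x v (i + 1) u].
Proof.
move=> vin vi vi1 d Ji Ji1.
have xx : x i < x (i + 1) by apply: x_incr; int_lia.
have r13 : 0 < r1 - r3 by speed_lra.
set u := (x (i + 1) - x i) / (r1 - r3).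
have u0 : 0 <= u by rewrite divr_ge0 ?ltW// subr_gt0.
have pe : position x v i u = position x v (i + 1) u.
  have : u * (r1 - r3) = x (i + 1) - x i by rewrite divfK ?gt_eqF.
  by rewrite /position vi vi1 mulrBr; lra.
exists u; have vge j : r3 <= v j by exact: (speeds_ge hr32 hr21).
suff : tau i = u%:E /\ tau (i + 1) = u%:E by case.
apply: (adjacent_collide vge vi1 d Ji Ji1 u0 pe) => j s Jj ji /andP[s0 su] _.
rewrite lt_eqF// /position ltr_leD ?x_incr// ler_wpM2l// vi.
exact: (speeds_le hr32 hr21).
Qed.

Section on_pattern.
Variable M : nat.
Variable v : int -> R.
Hypotheses (vin : speeds v) (hv : speed_pattern M v).

Let k := (2 * M + 2)%:Z.

Lemma pattern_v1 : v 1 = r1. Proof. by rewrite (hv (j := 1)) //; int_lia. Qed.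

Lemma pattern_vk : v k = r2.
Proof.
rewrite hv /pattern_speed ?eqxx; last by int_lia.
by case: eqP => // e; int_lia.
Qed.

Lemma pattern_vk1 : v (k + 1) = r3.
Proof.
have -> : k + 1 = (2 * M + 3)%:Z by rewrite /k; int_lia.
rewrite hv /pattern_speed; last by int_lia.
case: eqP => [e|_]; first by int_lia.
case: eqP => [e|_]; first by int_lia.
by case: ifP => // e; int_lia.
Qed.

(** Among the fillers 2, ..., 2M + 1 an even index opens a pair (r1, r3) and an odd one closes
    it. *)
Lemma pattern_filler j : 1 < j < k ->
  (v j = r1 /\ v (j + 1) = r3 /\ j + 1 < k) \/ (v j = r3 /\ v (j - 1) = r1 /\ 1 < j - 1).
Proof.
move=> jk; have [n jn] : exists n : nat, j = n%:Z by exists `|j|%N; int_lia.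
rewrite jn in jk *.
have n0 : (1 < n < 2 * M + 2)%N by move: jk; rewrite /k; int_lia.
case: (boolP (odd n)) => on; [right|left].
  have -> : n%:Z - 1 = n.-1%:Z by int_lia.
  rewrite (hv (j := n)); last by int_lia.
  rewrite (hv (j := n.-1)); last by int_lia.
  rewrite /pattern_speed on !ifF; try int_lia.
  by do !split=> //; int_lia.
have -> : n%:Z + 1 = n.+1%:Z by int_lia.
rewrite (hv (j := n)); last by int_lia.
rewrite (hv (j := n.+1)); last by int_lia.
rewrite /pattern_speed (negbTE on) /= on /= !ifF; try int_lia.
by do !split=> //; rewrite /k; int_lia.
Qed.

Lemma pattern_distance : gap_pattern M x -> (2 * M + 1)%:R <= x k - x 1.
Proof.
move=> hx.
have H n : (n <= 2 * M + 1)%N -> n%:R <= x (n%:Z + 1) - x 1.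
  elim: n => [|n IH] le_n; first by rewrite add0r subrr.
  have := IH ltac:(int_lia); have [/(_ n.+1 ltac:(int_lia)) + _] := hx.
  have -> : n%:Z + 1 = n.+1%:Z by int_lia.
  rewrite -natr1; lra.
have := H (2 * M + 1)%N (leqnn _).
by have -> : (2 * M + 1)%N%:Z + 1 = k by rewrite /k; int_lia.
Qed.

Lemma pattern_filler_partner J tau j : dyn x v J tau -> 1 < j < k -> J j ->
  (v j = r1 -> J (j + 1)) -> (v j = r3 -> J (j - 1)) ->
  (v j = r1 /\ v (j + 1) = r3 /\ j + 1 < k /\ exists u,
     [/\ tau j = u%:E, tau (j + 1) = u%:E & position x v j u = position x v (j + 1) u])
  \/ (v j = r3 /\ v (j - 1) = r1 /\ 1 < j - 1 /\ exists u,
     [/\ tau j = u%:E, tau (j - 1) = u%:E & position x v (j - 1) u = position x v j u]).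
Proof.
move=> d jk Jj J1 J3.
case: (pattern_filler jk) => -[vj [vj' lt]]; [left|right].
  by have := fast_slow_collide vin vj vj' d Jj (J1 vj).
have Ej : j - 1 + 1 = j by int_lia.
have := @fast_slow_collide v J tau (j - 1) vin vj'.
rewrite !Ej => /(_ vj d (J3 vj) Jj)[u [E1 E2 pe]].
by do !split=> //; exists u.
Qed.

(** This is where the choice of [M] acts: when 1 would reach [k], the particle [k + 1] would already
    have passed [k]. *)
Lemma pattern_late u : r1 - r2 < (2 * M + 1)%:R * (r2 - r3) -> gap_pattern M x ->
  position x v 1 u = position x v k u -> x (k + 1) - x k < u * (r2 - r3).
Proof.
move=> hM hx; rewrite /position pattern_v1 pattern_vk => pe.
have Eu : u * (r1 - r2) = x k - x 1 by rewrite mulrBr; lra.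
have [_ ] := hx; have -> : (2 * M + 3)%:Z = k + 1 by rewrite /k; int_lia.
rewrite -/k => /le_lt_trans; apply.
have r12 : 0 < r1 - r2 by speed_lra.
have r23 : 0 < r2 - r3 by speed_lra.
rewrite -(ltr_pM2r r12) mul1r (lt_le_trans hM)//.
have -> : u * (r2 - r3) * (r1 - r2) = u * (r1 - r2) * (r2 - r3) by ring.
by rewrite Eu ler_pM2r// pattern_distance.
Qed.

(** Nobody reaches [k] from the left in time: 0 has the same speed as [k], 1 is late by
    [pattern_late], a filler of speed [r3] falls back, and one of speed [r1] stays, while present,
    behind its partner of speed [r3]. *)
Lemma pattern_middle_collide J tau : r1 - r2 < (2 * M + 1)%:R * (r2 - r3) ->
  gap_pattern M x -> dyn x v J tau ->
  (forall j, 0 < j <= k + 1 -> J j) -> (forall j, J j -> 0 <= j) ->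
  (J 0 -> v 0 = r2) -> exists u,
  [/\ tau k = u%:E, tau (k + 1) = u%:E, position x v k u = position x v (k + 1) u
    & u * (r2 - r3) = x (k + 1) - x k].
Proof.
move=> hM hx d sJ J0 v0; have r23 : 0 < r2 - r3 by speed_lra.
have xx : x k < x (k + 1) by apply: x_incr; int_lia.
have k2 : 1 < k by rewrite /k; int_lia.
set u := (x (k + 1) - x k) / (r2 - r3).
have Eu : u * (r2 - r3) = x (k + 1) - x k by rewrite divfK ?gt_eqF.
have u0 : 0 <= u by rewrite divr_ge0 ?ltW// subr_gt0.
have pe : position x v k u = position x v (k + 1) u.
  by move: Eu; rewrite /position pattern_vk pattern_vk1 mulrBr; lra.
have Jk : J k by apply: sJ; int_lia.
have Jk1 : J (k + 1) by apply: sJ; int_lia.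
have vge j : r3 <= v j by exact: (speeds_ge hr32 hr21).
exists u.
suff : tau k = u%:E /\ tau (k + 1) = u%:E by case.
apply: (adjacent_collide vge pattern_vk1 d Jk Jk1 u0 pe) => j s Jj jk /andP[s0 su] le_j.
have lt3 i : i < k -> v i <= r2 -> position x v i s < position x v k s.
  by move=> ik vi; rewrite /position pattern_vk ltr_leD ?x_incr// ler_wpM2l.
have [j0|j0] := eqVneq j 0.
  by rewrite lt_eqF// lt3// j0 v0// -j0.
have [j1|j1] := eqVneq j 1.
  apply/eqP; rewrite j1 => /(pattern_late hM hx); rewrite -Eu ltr_pM2r//.
  by rewrite ltNge ltW.
have j_ge : 0 <= j by exact: J0.
have jk' : 1 < j < k by int_lia.
have [[vj [vj1 [lt [w [E1 E2 pw]]]]]|[vj _]] :=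
  pattern_filler_partner d jk' Jj (fun _ => sJ (j + 1) ltac:(int_lia)) (fun _ => sJ (j - 1) ltac:(int_lia)).
  rewrite lt_eqF//; apply: (@le_lt_trans _ _ (position x v (j + 1) s)).
    apply: (dyn_order x_incr d) => //; [by apply: sJ; int_lia|int_lia|by rewrite E2 -E1].
  by apply: lt3 => //; rewrite vj1 ltW.
by rewrite lt_eqF// lt3// vj ltW.
Qed.

Lemma pattern_hit : hit r2 x v k 1.
Proof.
set w := set_speed r2 v k.
have wE : w =1 v.
  by move=> i; rewrite /w /set_speed; case: ifP => // /eqP ->; rewrite pattern_vk.
rewrite /hit (@meet_congr _ _ x_incr _ v); last by move=> i _; exact: wE.
have r23 : 0 < r2 - r3 by speed_lra.
have xx : x k < x (k + 1) by apply: x_incr; int_lia.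
set u := (x (k + 1) - x k) / (r2 - r3).
have Eu : u * (r2 - r3) = x (k + 1) - x k by rewrite divfK ?gt_eqF.
have u0 : 0 <= u by rewrite divr_ge0 ?ltW// subr_gt0.
have pe : position x v k u = position x v (k + 1) u.
  by move: Eu; rewrite /position pattern_vk pattern_vk1 mulrBr; lra.
have d := window_time_dyn x_incr v k 1.
have vge j : r3 <= v j by exact: (speeds_ge hr32 hr21).
apply/(meetP x_incr); exists (window_time x v k 1), u.
have Jk : k <= k <= k + 1%N%:Z by int_lia.
have Jk1 : k <= k + 1 <= k + 1%N%:Z by int_lia.
suff [E1 E2] : window_time x v k 1 k = u%:E /\ window_time x v k 1 (k + 1) = u%:E by split.
apply: (adjacent_collide vge pattern_vk1 d Jk Jk1 u0 pe) => j s /andP[kj _] jk.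
by move: (lt_le_trans jk kj); rewrite ltxx.
Qed.

(** A filler of speed [r1] keeps its lead over 1; one of speed [r3] stays, while present, ahead of
    its partner of speed [r1]. *)
Lemma pattern_not_partner J tau j u : dyn x v J tau -> 1 < j < k ->
  (forall i, 1 <= i <= j -> J i) -> (v j = r1 -> J (j + 1)) ->
  (u%:E <= tau j)%E -> 0 <= u -> position x v 1 u != position x v j u.
Proof.
move=> d jk sJ J1 le_j u0.
have lt1 i : 1 < i -> v i = r1 -> position x v 1 u < position x v i u.
  by move=> i1 vi; rewrite /position pattern_v1 vi ltrD2r x_incr.
case: (pattern_filler jk) => -[vj [vj1 lt]].
  by rewrite lt_eqF// lt1//; int_lia.
have Jj : J j by apply: sJ; int_lia.
have Jj1 : J (j - 1) by apply: sJ; int_lia.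
have [[vj' _]|[_ [_ [_ [w [E1 E2 pw]]]]]] := pattern_filler_partner d jk Jj J1 (fun _ => Jj1).
  by exfalso; move: vj'; rewrite vj; speed_lra.
rewrite lt_eqF//; apply: (@lt_le_trans _ _ (position x v (j - 1) u)); first exact: lt1.
by apply: (dyn_order x_incr d) => //; [int_lia|rewrite E2 -E1].
Qed.

(** In the absence of [k + 1], the particle [k] waits for 1: every filler stays strictly between
    them as long as it is present. *)
Lemma pattern_meet : meet x v 1 (2 * M + 1).
Proof.
have d := window_time_dyn x_incr v 1 (2 * M + 1).
set tau := window_time _ _ _ _ in d *.
have Ek : 1 + (2 * M + 1)%N%:Z = k by rewrite /k; int_lia.
have k2 : 1 < k by rewrite /k; int_lia.
rewrite Ek in d; have [ge0 hit meet] := d.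
have r12 : 0 < r1 - r2 by speed_lra.
have xx : x 1 < x k by apply: x_incr.
set t := (x k - x 1) / (r1 - r2).
have Et : t * (r1 - r2) = x k - x 1 by rewrite divfK ?gt_eqF.
have t0 : 0 <= t by rewrite divr_ge0 ?ltW// subr_gt0.
have pe : position x v 1 t = position x v k t.
  by move: Et; rewrite /position pattern_v1 pattern_vk mulrBr; lra.
have ne : 1 != k by int_lia.
have nfiller j u : 1 < j < k -> (u%:E <= tau j)%E -> 0 <= u ->
    position x v 1 u < position x v j u /\ position x v j u < position x v k u.
  move=> jk le_j u0.
  have J0 : 1 <= j <= k by int_lia.
  have lt1 i : 1 < i -> v i = r1 -> position x v 1 u < position x v i u.
    by move=> i1 vi; rewrite /position pattern_v1 vi ltrD2r x_incr.
  have lt3 i : i < k -> v i = r3 -> position x v i u < position x v k u.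
    by move=> ik vi; rewrite /position pattern_vk vi ltr_leD ?x_incr// ler_wpM2l// ltW.
  have J1 : 1 <= j + 1 <= k by int_lia.
  have J3 : 1 <= j - 1 <= k by int_lia.
  have [[vj [vj1 [lt [w [E1 E2 pw]]]]]|[vj [vj1 [lt [w [E1 E2 pw]]]]]] :=
    pattern_filler_partner d jk J0 (fun _ => J1) (fun _ => J3); split.
  - by apply: lt1 => //; int_lia.
  - apply: (@le_lt_trans _ _ (position x v (j + 1) u)); last exact: lt3.
    by apply: (dyn_order x_incr d) => //; [int_lia|rewrite E2 -E1].
  - apply: (@lt_le_trans _ _ (position x v (j - 1) u)); first exact: lt1.
    by apply: (dyn_order x_incr d) => //; [int_lia|rewrite E2 -E1].
  - by apply: lt3 => //; int_lia.
have J1 : 1 <= (1 : int) <= k by int_lia.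
have Jk : 1 <= k <= k by int_lia.
have alive1 : (t%:E <= tau 1%R)%E.
  case E1 : (tau 1%R) (ge0 1 J1) => [s| |] // s0; last exact: leey.
  rewrite lee_fin in s0; rewrite lee_fin leNgt; apply/negP => st.
  have [j [Jj j1 pj le_j]] := hit 1 s J1 E1.
  have [jk|jk] := eqVneq j k.
    by rewrite jk in pj; have := collision_uniq x_incr ne (esym pj) pe; lra.
  by have [] := nfiller j s ltac:(int_lia) le_j s0; rewrite pj ltxx.
have alivek : (t%:E <= tau k)%E.
  case E1 : (tau k) (ge0 k Jk) => [s| |] // s0; last exact: leey.
  rewrite lee_fin in s0; rewrite lee_fin leNgt; apply/negP => st.
  have [j [Jj jk pj le_j]] := hit k s Jk E1.
  have [j1|j1] := eqVneq j 1.
    by rewrite j1 in pj; have := collision_uniq x_incr ne pj pe; lra.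
  by have [_] := nfiller j s ltac:(int_lia) le_j s0; rewrite pj ltxx.
have [E1 E2] := meet 1 k t J1 Jk ne t0 pe alive1 alivek.
by apply/(meetP x_incr); exists tau, t; rewrite Ek; split=> //; int_lia.
Qed.

Lemma pattern_no_early_meet j : (j < 2 * M + 1)%N -> ~~ meet x v 1 j.
Proof.
move=> jM; apply/negP => m; have j0 := meet_gt0 m.
move: m => /(meetP x_incr)[tau [t [d _ E1 Ej pe]]].
have t0 : 0 <= t by have [/(_ 1) + _ _] := d; rewrite E1 lee_fin; apply; int_lia.
have jk : 1 < 1 + j%:Z < k by rewrite /k; int_lia.
case: (pattern_filler jk) => -[vj [vj1 lt]].
  have := x_incr (_ : 1 < 1 + j%:Z); move: pe; rewrite /position vj pattern_v1.
  by move=> /addIr -> /(_ ltac:(int_lia)); rewrite ltxx.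
suff : position x v 1 t != position x v (1 + j%:Z) t by rewrite pe eqxx.
apply: (pattern_not_partner d jk) => //; last by rewrite Ej.
by rewrite vj => r31; exfalso; move: r31; speed_lra.
Qed.

End on_pattern.

(** Particle 1 must vanish before 0 is hit, but the fillers never touch it and [k], [k + 1] remove
    each other too early, so its partner lies beyond [k + 1 = 2M + 3]. That partner is [1 + j],
    whence the bound [2 * M + 2 < j]. *)
Lemma pattern_second_meet M v m : r1 - r2 < (2 * M + 1)%:R * (r2 - r3) ->
  gap_pattern M x -> speeds v -> speed_pattern M v -> hit r2 x v 0 m ->
  exists j, [/\ (2 * M + 2 < j)%N, (1 + j < m)%N & meet x v 1 j].
Proof.
move=> hM hx vin hv /(hitP x_incr)[tau [t [d m0 E0 Em pe]]].
set w := set_speed r2 v 0 in d pe.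
have win : speeds w by exact: speeds_set.
have hw : speed_pattern M w.
  by move=> j j0; rewrite -hv// /w /set_speed ifF//; int_lia.
have w1 : w 1 != r3 by rewrite (pattern_v1 hw) gt_eqF//; speed_lra.
have [j [u [jm E1 Ej pj]]] := first_collides x_incr hr32 hr21 win erefl w1 d m0 E0 Em pe.
have u0 : 0 <= u by have [/(_ 1) + _ _] := d; rewrite E1 lee_fin; apply; int_lia.
have jM : (2 * M + 3)%:Z < j.
  rewrite ltNge; apply/negP => jM.
  have [jk|jk] := ltP j (2 * M + 2)%:Z.
    suff : position x w 1 u != position x w j u by rewrite pj eqxx.
    apply: (pattern_not_partner win hw d) => //; try by rewrite Ej.
    - by int_lia.
    - by move=> i; int_lia.
    - by move=> _; int_lia.
  have sJ i : 0 < i <= (2 * M + 2)%:Z + 1 -> 0 <= i <= m%:Z by int_lia.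
  have J0 i : 0 <= i <= m%:Z -> 0 <= i by int_lia.
  have [z [Ek Ek1 pk Ez]] := pattern_middle_collide win hw hM hx d sJ J0 (fun _ => erefl).
  (* A collision of 1 with [k] or [k + 1] would put 1 at the place of [k] at the very time [z] at
     which [k] meets [k + 1], against [pattern_late]. *)
  suff [p1 zu] : position x w 1 u = position x w (2 * M + 2)%:Z u /\ z = u.
    by have := pattern_late hw hM hx p1; rewrite -zu Ez ltxx.
  have [jE|jE] := eqVneq j (2 * M + 2)%:Z.
    by rewrite -jE pj; split=> //; move: Ek; rewrite -jE Ej => -[].
  have {}jE : j = (2 * M + 2)%:Z + 1 by int_lia.
  have zu : z = u by move: Ek1; rewrite -jE Ej => -[].
  by split=> //; rewrite pj jE -zu pk.
exists `|j - 1|%N; split; [int_lia|int_lia|].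
rewrite (@meet_congr _ _ x_incr _ w).
  by apply: (meet_of_dyn x_incr d) E1 Ej pj => [|i]; int_lia.
by move=> i i1; rewrite /w /set_speed ifF//; int_lia.
Qed.

End pattern.

(** * The infinite system *)

Section infinite.
Context {R : realType}.
Variables (x v : int -> R) (V : R).
Hypothesis x_incr : forall i j, i < j -> x i < x j.
Hypothesis x_unbounded : forall M, exists n : nat, forall i, `|x i| <= M -> `|i| <= n%:Z.
Hypothesis v_bounded : forall i, `|v i| <= V.

Definition central_time (n : nat) := window_time x v (- n%:Z) (n + n).

(** A backward light cone with base [-M, M]: since speeds are bounded by [V], the quantity bounded
    by [M] never decreases along a trajectory. *)
Let cone M (i : int) (s : R) := 0 <= s /\ `|position x v i s| + V * s <= M.

Lemma central_time_dyn n : dyn x v (fun i => `|i| <= n%:Z) (central_time n).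
Proof.
apply: dyn_congr (window_time_dyn x_incr v (- n%:Z) (n + n)) => // i.
by apply/idP/idP; int_lia.
Qed.

Lemma cone_base M i s : cone M i s -> `|x i| <= M.
Proof.
move=> [s0]; apply: le_trans.
have -> : x i = position x v i s - s * v i by rewrite /position addrK.
apply: le_trans (ler_normB _ _) _; rewrite lerD2l normrM ger0_norm// mulrC.
by rewrite ler_wpM2r.
Qed.

Lemma cone_down M i s u : cone M i s -> 0 <= u <= s -> cone M i u.
Proof.
move=> [s0 le] /andP[u0 us]; split=> //; apply: le_trans le.
have -> : position x v i u = position x v i s - (s - u) * v i.
  by rewrite /position; ring.
have su : 0 <= s - u by rewrite subr_ge0.
have := ler_normB (position x v i s) ((s - u) * v i).
have : `|(s - u) * v i| <= (s - u) * V by rewrite normrM ger0_norm// ler_wpM2l.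
by rewrite mulrBl (mulrC V) (mulrC V); lra.
Qed.

Lemma cone_agree M J J' (F : seq int) tau tau' : dyn x v J tau -> dyn x v J' tau' ->
  (forall i, `|x i| <= M -> J i = J' i) -> (forall i, `|x i| <= M -> i \in F) ->
  forall i s, J i -> cone M i s -> tau i = s%:E -> tau' i = s%:E.
Proof.
move=> d d' JJ' MF; apply: (@dyn_agree _ x v J J' F (cone M)) d d' => //.
- by move=> i s /cone_base/JJ'.
- by move=> i s /cone_base/MF.
- by move=> i k s [s0 le] pe; split=> //; rewrite pe.
- by move=> i s u; exact: cone_down.
Qed.

Lemma central_agree n m i s : `|i| <= n%:Z ->
  (forall k, `|x k| <= `|position x v i s| + V * s -> `|k| <= n%:Z) ->
  (forall k, `|x k| <= `|position x v i s| + V * s -> `|k| <= m%:Z) ->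
  central_time n i = s%:E -> central_time m i = s%:E.
Proof.
move=> in_n cn cm Ei.
have s0 : 0 <= s.
  by rewrite -lee_fin -Ei; case: (central_time_dyn n) => [+ _ _]; apply.
apply: (@cone_agree (`|position x v i s| + V * s) _ _ (window (- n%:Z) (n + n))
  _ _ (central_time_dyn n) (central_time_dyn m) _ _ i s) Ei => //.
- by move=> k ck; rewrite cn ?cm.
- by move=> k /cn; rewrite mem_window; int_lia.
Qed.

(** Whether [i] is removed at [s] is decided by the finitely many particles of the light cone below,
    so all central windows covering this cone agree. [tau i] is the common value, or [+oo] when no
    covering window removes [i]. *)
Lemma annihilation_times_exist : exists tau, annihilation_times x v tau.
Proof.
pose covers n i s := `|i| <= n%:Z /\
  forall k, `|x k| <= `|position x v i s| + V * s -> `|k| <= n%:Z.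
have coversE i s : exists n, covers n i s.
  have [n Hn] := x_unbounded (`|position x v i s| + V * s).
  exists (n + `|i|)%N; split; first by int_lia.
  by move=> k /Hn; int_lia.
have /choice[tau Htau] i : exists y : \bar R,
    (forall n s, covers n i s -> central_time n i = s%:E -> y = s%:E) /\
    (forall s, y = s%:E -> exists n, covers n i s /\ central_time n i = s%:E)
    /\ (0 <= y)%E.
  have [[n [s [cn En]]]|none] := pselect (exists n s, covers n i s /\ central_time n i = s%:E).
    exists s%:E; split; last split.
    - move=> m u [im cm] Em; case: cn => in_n cn.
      have En' : central_time (n + m) i = s%:E.
        by apply: (@central_agree n) En => // k /cn; int_lia.
      rewrite -En'; apply: (@central_agree m) Em => // k /cm; int_lia.
    - by move=> _ [<-]; exists n.
    - rewrite -En; case: (central_time_dyn n) => [+ _ _]; apply.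
      by case: cn.
  exists +oo%E; split; last by split => //; rewrite leey.
  by move=> n s cn En; case: none; exists n, s.
have ge0 i : (0 <= tau i)%E by have [_ []] := Htau i.
exists tau; split=> // [i s Ei|i j s ij s0 pe le_i le_j].
  have [n [[in_n cn] En]] := (Htau i).2.1 _ Ei.
  have s0 : 0 <= s by rewrite -lee_fin -Ei.
  have [ge hit meet] := central_time_dyn n.
  have [j [jn ji pj le_j]] := hit i s in_n En.
  have ij : i != j by rewrite eq_sym.
  have le_i : (s%:E <= central_time n i)%E by rewrite En.
  have [_ Ej] := meet i j s in_n jn ij s0 (esym pj) le_i le_j.
  exists j; split=> //; rewrite ((Htau j).1 n s)//.
  by split=> // k; rewrite pj; exact: cn.
have [n [in_n cn]] := coversE i s.
have cj : covers (n + `|j|)%N j s.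
  by split; [int_lia|rewrite -pe => k /cn; int_lia].
have ci : covers (n + `|j|)%N i s by split; [int_lia|move=> k /cn; int_lia].
set m := (n + `|j|)%N in ci cj.
(* An earlier removal at [u] in the window would be decided by the cone at [u], which lies in the
   one at [s]; it would then be the value of [tau k]. *)
have alive k : covers m k s -> (s%:E <= tau k)%E -> (s%:E <= central_time m k)%E.
  move=> [km ck] le_k; case: (central_time_dyn m) => [/(_ k km) + _ _].
  case Ek : (central_time m k) => [u| |]; [|by move=> _; exact: leey|by []].
  rewrite !lee_fin => u0; rewrite leNgt; apply/negP => us.
  suff Et : tau k = u%:E by move: le_k; rewrite Et lee_fin leNgt us.
  apply: (Htau k).1 Ek; split=> // l le_l; apply: ck; apply: le_trans le_l _.
  have us' : 0 <= u <= s by rewrite u0 ltW.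
  by case: (cone_down (conj s0 (lexx (`|position x v k s| + V * s))) us').
have [_ _ meet] := central_time_dyn m.
have [Ei Ej] := meet i j s ci.1 cj.1 ij s0 pe (alive i ci le_i) (alive j cj le_j).
by split; [apply: (Htau i).1 ci Ei|apply: (Htau j).1 cj Ej].
Qed.

(** [survives] quantifies over functions [tau] and is not visibly measurable; the right-hand side is
    a countable combination of events on finite windows. A finite removal time of 0 would be
    reported by every large window. *)
Lemma survives_central : survives x v 0 <->
  forall N : nat, exists n0, forall n, (n0 <= n)%N -> (N%:R%:E < central_time n 0%R)%E.
Proof.
have V0 : 0 <= V by apply: le_trans (v_bounded 0).
split=> [[tau d tau0] N|H].
  have [n0 Hn0] := x_unbounded (`|x 0| + N%:R * V + V * N%:R).
  exists n0 => n n0n; rewrite ltNge; apply/negP => le_N.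
  have [ge0 _ _] := central_time_dyn n.
  case E : (central_time n 0) (ge0 0 ltac:(int_lia)) le_N => [s| |] //; rewrite !lee_fin => s0 sN.
  suff : tau 0 = s%:E by rewrite tau0.
  apply: (@cone_agree (`|x 0| + N%:R * V + V * N%:R) _ _ (window (- n%:Z) (n + n)) _ _
    (central_time_dyn n) (proj2 (dynT x v tau) d) _ _ 0 s) E => //.
  - by move=> i /Hn0 in0; rewrite /predT /=; int_lia.
  - by move=> i /Hn0; rewrite mem_window; int_lia.
  - split=> //.
    rewrite lerD//; last by rewrite ler_wpM2l.
    apply: le_trans (ler_normD _ _) _; rewrite lerD2l normrM ger0_norm//.
    by rewrite ler_pM.
have [tau d] := annihilation_times_exist; exists tau => //.
have [ge0 _ _] := d; case E : (tau 0) (ge0 0) => [s| |] // s0.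
rewrite lee_fin in s0.
have [n1 Hn1] := x_unbounded (`|position x v 0 s| + V * s).
have [n0 Hn0] := H (Num.truncn s).+1.
have := Hn0 (n0 + n1)%N (leq_addr _ _).
rewrite (@cone_agree (`|position x v 0 s| + V * s) predT _ (window (- n1%:Z) (n1 + n1)) _ _
    (proj2 (dynT x v tau) d) (central_time_dyn (n0 + n1)) _ _ 0 s) //.
- by rewrite lte_fin ltNge ltW// truncnS_gt.
- by move=> i /Hn1 in1; rewrite /predT /=; int_lia.
- by move=> i /Hn1; rewrite mem_window; int_lia.
Qed.

End infinite.

(** * From hits on either side to survival *)

Section reflection.
Context {R : realType}.
Implicit Types (x v : int -> R).

Definition reflect_conf x : int -> R := fun i => - x (- i).

Lemma reflect_position x v i t :
  position (reflect_conf x) (reflect_conf v) i t = - position x v (- i) t.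
Proof. by rewrite /position /reflect_conf; ring. Qed.

(** Whatever removes 0 lies on one side of it, and the collision is visible in the window between
    the two; the left-hand case is the right-hand one after reflection. *)
Lemma survives_not_hit x v (V r2 : R) :
  (forall i j, i < j -> x i < x j) ->
  (forall M, exists n : nat, forall i, `|x i| <= M -> `|i| <= n%:Z) ->
  (forall i, `|v i| <= V) -> v 0 = r2 ->
  (forall n, ~~ hit r2 x v 0 n) ->
  (forall n, ~~ hit (- r2) (reflect_conf x) (reflect_conf v) 0 n) ->
  survives x v 0.
Proof.
move=> x_incr x_unb v_bnd v0 nohit_r nohit_l.
have right_hit x' v' r tau t j : (forall i j, i < j -> x' i < x' j) -> v' 0 = r ->
    annihilation_times x' v' tau -> 0 < j -> tau 0 = t%:E -> tau j = t%:E ->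
    position x' v' 0 t = position x' v' j t -> hit r x' v' 0 `|j|%N.
  move=> x'_incr v'0 /dynT d j0 E0 Ej pe; rewrite /hit.
  have E : set_speed r v' 0 =1 v' by move=> i; rewrite /set_speed; case: eqP => // ->.
  rewrite (@meet_congr _ _ x'_incr _ v'); last by move=> i _; exact: E.
  by have := meet_of_dyn x'_incr d j0 (fun _ _ => isT) E0 Ej pe; rewrite subr0.
have [tau d] := annihilation_times_exist x_incr x_unb v_bnd; exists tau => //.
have [ge0 hit_t meet_t] := d.
case E0 : (tau 0) (ge0 0) => [t| |] //; rewrite lee_fin => t0.
have [j [j0 pj le_j]] := hit_t _ _ E0.
have ne : 0 != j by rewrite eq_sym.
have [_ Ej] := meet_t 0 j t ne t0 (esym pj) ltac:(by rewrite E0) le_j.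
exfalso; case: (ltgtP 0 j) ne => // jpos _.
  by have := right_hit x v r2 tau t j x_incr v0 d jpos E0 Ej (esym pj); rewrite (negbTE (nohit_r _)).
have d' : annihilation_times (reflect_conf x) (reflect_conf v) (fun i => tau (- i)).
  apply/dynT; apply: (@dyn_reindex _ x v _ _ predT _ (fun i => - i) (fun i => - i)).
  - exact: opprK.
  - exact: opprK.
  - by move=> i j' t'; rewrite !reflect_position; split=> [/oppr_inj|->].
  - exact/dynT.
have x'_incr i k : i < k -> reflect_conf x i < reflect_conf x k.
  by move=> ik; rewrite /reflect_conf ltrN2 x_incr// ltrN2.
have v'0 : reflect_conf v 0 = - r2 by rewrite /reflect_conf oppr0 v0.
have j0' : 0 < - j by int_lia.
have E0' : tau (- 0) = t%:E by rewrite oppr0.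
have Ej' : tau (- - j) = t%:E by rewrite opprK.
have pe' : position (reflect_conf x) (reflect_conf v) 0 t =
    position (reflect_conf x) (reflect_conf v) (- j) t.
  by rewrite !reflect_position oppr0 opprK pj.
have := right_hit _ _ _ _ t (- j) x'_incr v'0 d' j0' E0' Ej' pe'.
by rewrite (negbTE (nohit_l _)).
Qed.

End reflection.

(** * Independence and measurability *)

Section rectangles.
Context {R : realType} {T : pointedType} {I : choiceType}.
Implicit Types (X : I -> T -> R) (D : set I).

Definition rectangle X (J : {fset I}) (B : I -> set R) : set T :=
  \bigcap_(i in [set` J]) (X i @^-1` B i).

(** A pi-system generating the sigma-algebra of the coordinates in [D]. *)
Definition rectangles X D : set (set T) :=
  [set A | exists J B, [/\ forall i, i \in J -> D i,
     forall i, measurable (B i) & A = rectangle X J B]].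

Definition pad (J : {fset I}) (B : I -> set R) (i : I) : set R :=
  if i \in J then B i else setT.

Lemma rectangle_pad X (J K : {fset I}) B : (J `<=` K)%fset ->
  rectangle X J B = rectangle X K (pad J B).
Proof.
move=> /fsubsetP JK; apply/seteqP; split=> w H i /= iJ.
  by rewrite /pad; case: ifP => // iJ'; apply: H.
by have := H i (JK _ iJ); rewrite /pad iJ.
Qed.

Lemma measurable_pad (J : {fset I}) B : (forall i, measurable (B i)) ->
  forall i, measurable (pad J B i).
Proof. by move=> mB i; rewrite /pad; case: ifP. Qed.

Lemma rectanglesI X D : setI_closed (rectangles X D).
Proof.
move=> _ _ [J1 [B1 [D1 m1 ->]]] [J2 [B2 [D2 m2 ->]]].
exists (J1 `|` J2)%fset, (fun i => pad J1 B1 i `&` pad J2 B2 i); split.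
- by move=> i; rewrite inE => /orP[/D1|/D2].
- by move=> i; apply: measurableI; exact: measurable_pad.
- rewrite (@rectangle_pad _ J1 (J1 `|` J2)%fset) ?fsubsetUl//.
  rewrite (@rectangle_pad _ J2 (J1 `|` J2)%fset) ?fsubsetUr//.
  by rewrite /rectangle -bigcapI.
Qed.

Lemma rectanglesT X D : rectangles X D setT.
Proof.
exists fset0, (fun _ => setT); split=> //.
by apply/seteqP; split.
Qed.

Lemma measurable_coordinate X D i : D i ->
  measurable_fun setT (X i : g_sigma_algebraType (rectangles X D) -> R).
Proof.
move=> Di _ B mB; rewrite setTI; apply: sub_sigma_algebra.
exists [fset i]%fset, (fun _ => B); split=> // [j|]; first by rewrite inE => /eqP ->.
apply/seteqP; split=> w /= H; first by move=> j /=; rewrite inE => /eqP ->.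
by apply: H; rewrite /= inE.
Qed.

Lemma sigma_rectanglesI X D (A B : set T) : <<s rectangles X D >> A ->
  <<s rectangles X D >> B -> <<s rectangles X D >> (A `&` B).
Proof. exact: (@measurableI _ (g_sigma_algebraType (rectangles X D))). Qed.

Lemma sigma_rectanglesS X (D1 D2 : set I) (A : set T) : D1 `<=` D2 ->
  <<s rectangles X D1 >> A -> <<s rectangles X D2 >> A.
Proof.
move=> D12; move: A; apply: (smallest_sub (smallest_sigma_algebra _ _)).
move=> B [J [C [D1J mC ->]]]; apply: sub_sigma_algebra.
by exists J, C; split=> // i /D1J/D12.
Qed.

End rectangles.

Section independence.
Context {R : realType} {d : measure_display} {T : measurableType d}.
Variable P : probability T R.

Lemma measurable_rectangles (I : choiceType) (X : I -> T -> R) D :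
  (forall i, measurable_fun setT (X i)) -> rectangles X D `<=` measurable.
Proof.
move=> mX _ [J [B [_ mB ->]]]; rewrite /rectangle.
apply: fin_bigcap_measurable; first exact: finite_fset.
by move=> i _; rewrite -[X in measurable X]setTI; exact: mX.
Qed.

Lemma measurable_sigma_rectangles (I : choiceType) (X : I -> T -> R) D :
  (forall i, measurable_fun setT (X i)) -> <<s rectangles X D >> `<=` measurable.
Proof.
move=> mX; apply: smallest_sub; first exact: sigma_algebra_measurable.
exact: measurable_rectangles.
Qed.

Lemma rectangles_independent (I : choiceType) (X : I -> T -> R) D1 D2 A1 A2 :
  mutually_independent P X -> (forall i, D1 i -> D2 i -> False) ->
  rectangles X D1 A1 -> rectangles X D2 A2 ->
  P (A1 `&` A2) = (P A1 * P A2)%E.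
Proof.
move=> ind disj [J1 [B1 [D1J m1 ->]]] [J2 [B2 [D2J m2 ->]]].
rewrite (@rectangle_pad _ _ _ X J1 (J1 `|` J2)%fset) ?fsubsetUl//.
rewrite (@rectangle_pad _ _ _ X J2 (J1 `|` J2)%fset) ?fsubsetUr//.
have mp1 i : measurable (pad J1 B1 i) by exact: measurable_pad.
have mp2 i : measurable (pad J2 B2 i) by exact: measurable_pad.
have mp12 i : measurable (pad J1 B1 i `&` pad J2 B2 i) by exact: measurableI.
rewrite /rectangle -bigcapI (ind _ _ mp1) (ind _ _ mp2).
apply: (etrans (ind _ _ mp12)); rewrite -big_split; apply: eq_bigr => i _ /=; rewrite /pad.
have [i1|] := boolP (i \in J1); have [i2|] := boolP (i \in J2).
- by case: (disj i); [exact: D1J|exact: D2J].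
- by rewrite setIT preimage_setT probability_setT mule1.
- by rewrite setTI preimage_setT probability_setT mul1e.
- by rewrite setTI preimage_setT probability_setT mul1e.
Qed.

Lemma sigma_rectangles_independent (I : choiceType) (X : I -> T -> R) D1 D2 A1 A2 :
  (forall i, measurable_fun setT (X i)) ->
  mutually_independent P X -> (forall i, D1 i -> D2 i -> False) ->
  <<s rectangles X D1 >> A1 -> <<s rectangles X D2 >> A2 ->
  P (A1 `&` A2) = (P A1 * P A2)%E.
Proof.
move=> mX ind disj.
(* For fixed [C] the measures P(A and C) and P(A) P(C) of [A] agree on the rectangles, hence on the
   sigma-algebra that these generate. This is applied to each of the two events in turn. *)
have unique D C A : measurable C -> <<s rectangles X D >> A ->
    (forall B, rectangles X D B -> P (B `&` C) = (P B * P C)%E) ->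
    P (A `&` C) = (P A * P C)%E.
  move=> mC sA H.
  have c0 : 0 <= fine (P C) by exact: fine_ge0.
  have cE : P C = (fine (P C))%:E by rewrite fineK// fin_num_measure.
  have scaleE B : mscale (NngNum c0) P B = (P B * P C)%E.
    by rewrite /mscale/= muleC [in RHS]cE.
  rewrite -scaleE -[LHS]/(mrestr P mC A).
  apply: (@g_sigma_algebra_measure_unique d R T (rectangles X D)
    (measurable_rectangles mX) (fun _ => setT)) => //.
  - by move=> _; exact: rectanglesT.
  - by rewrite bigcup_const.
  - exact: rectanglesI.
  - by move=> B rB; apply: (etrans (H _ rB)); rewrite -scaleE.
  - by move=> k; rewrite /= /mrestr (le_lt_trans (probability_le1 _ _)) ?ltry// setTI.
move=> s1 s2; have m2 := measurable_sigma_rectangles mX s2.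
apply: (unique D1) => // B1 r1; have mB1 := measurable_rectangles mX r1.
rewrite setIC [RHS]muleC; apply: (unique D2) => // B2 r2.
by rewrite setIC [RHS]muleC; exact: rectangles_independent r1 r2.
Qed.

(** Both families have a distribution on the product sigma-algebra of [I -> R], which is determined
    by finite-dimensional rectangles. *)
Lemma law_unique (I : choiceType) (X Y : I -> T -> R) (S : set (I -> R)) :
  (forall i, measurable_fun setT (X i)) -> (forall i, measurable_fun setT (Y i)) ->
  (forall J B, (forall i, measurable (B i)) -> P (rectangle X J B) = P (rectangle Y J B)) ->
  <<s rectangles (fun i (f : I -> R) => f i) setT >> S ->
  P [set w | S (X ^~ w)] = P [set w | S (Y ^~ w)].
Proof.
move=> mX mY XY sS.
pose E : set (set (I -> R)) := rectangles (fun i (f : I -> R) => f i) setT.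
have mZ (Z : I -> T -> R) : (forall i, measurable_fun setT (Z i)) ->
    measurable_fun setT ((fun w i => Z i w) : T -> g_sigma_algebraType E).
  move=> mZ; apply: (@measurability _ _ _ (g_sigma_algebraType E) _ _ E) => //.
  move=> _ [A [J [B [_ mB ->]]] <-]; rewrite setTI.
  by apply: (measurable_rectangles (D := setT) mZ); exists J, B; split.
pose X' : {mfun T >-> g_sigma_algebraType E} := mfun_Sub (mem_set (mZ _ mX)).
pose Y' : {mfun T >-> g_sigma_algebraType E} := mfun_Sub (mem_set (mZ _ mY)).
rewrite -[LHS]/(distribution P X' S) -[RHS]/(distribution P Y' S).
apply: (@g_sigma_algebra_measure_unique _ R (g_sigma_algebraType E) E
  (@sub_sigma_algebra _ setT E) (fun _ => setT)) => //.
- by move=> _; exact: rectanglesT.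
- by rewrite bigcup_const.
- exact: rectanglesI.
- by move=> _ [J [B [_ mB ->]]]; exact: XY.
- by move=> k; rewrite (le_lt_trans (probability_le1 _ _)) ?ltry.
Qed.



End independence.

(** * Measurability of events on a window *)

Section measurability.
Context {R : realType} {d : measure_display} {T : measurableType d}.
Implicit Types (X V : int -> T -> R) (s : seq int).

Lemma measurable_inv : measurable_fun [set: R] (@GRing.inv R).
Proof.
have -> : @GRing.inv R = (fun x => if x == 0 then 0 else x^-1).
  by apply/funext => x; case: eqP => // ->; rewrite invr0.
apply: measurable_fun_if => //; first exact: measurable_fun_eqr.
have -> : [set: R] `&` (fun x : R => x == 0) @^-1` [set false] = [set x : R | x != 0].
  by rewrite setTI; apply/seteqP; split=> x /=; case: eqP.
apply: subspace_continuous_measurable_fun.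
  have -> : [set x : R | x != 0] = ~` [set 0].
    by apply/seteqP; split=> x /= /eqP.
  by apply: measurableC; exact: measurable_set1.
by apply: continuous_in_subspaceT => x; rewrite inE /= => /inv_continuous.
Qed.

(** The random sublist takes finitely many values; deciding on one element at a time reduces the
    claim to fixed lists. *)
Lemma measurable_filter (p : int -> T -> bool) s (F : seq int -> T -> \bar R) :
  (forall i, i \in s -> measurable_fun setT (p i)) ->
  (forall l, {subset l <= s} -> measurable_fun setT (F l)) ->
  measurable_fun setT (fun w => F [seq i <- s | p i w] w).
Proof.
elim: s F => [|j s IH] F mp mF /=; first exact: mF.
have -> : (fun w => F (if p j w then j :: [seq i <- s | p i w] else [seq i <- s | p i w]) w) =
    (fun w => if p j w then F (j :: [seq i <- s | p i w]) w else F [seq i <- s | p i w] w).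
  by apply/funext => w; case: ifP.
have mp' i : i \in s -> measurable_fun setT (p i).
  by move=> si; apply: mp; rewrite inE si orbT.
apply: measurable_fun_ifT; first by apply: mp; rewrite mem_head.
  apply: (IH (fun l => F (j :: l))) => // l sl; apply: mF => i.
  by rewrite !inE => /orP[->//|/sl ->]; rewrite orbT.
apply: (IH F) => // l sl; apply: mF => i /sl si.
by rewrite inE si orbT.
Qed.

Lemma measurable_bigmine (I : eqType) (s : seq I) (f : I -> T -> \bar R) :
  (forall i, i \in s -> measurable_fun setT (f i)) ->
  measurable_fun setT (fun w => \big[mine/+oo%E]_(i <- s) f i w).
Proof.
elim: s => [|i s IH] mf.
  by under eq_fun do rewrite big_nil; exact: measurable_cst.
under eq_fun do rewrite big_cons; apply: measurable_mine.
  by apply: mf; rewrite mem_head.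
by apply: IH => j sj; apply: mf; rewrite inE sj orbT.
Qed.

Lemma measurable_has (I : eqType) (s : seq I) (p : I -> T -> bool) :
  (forall i, i \in s -> measurable_fun setT (p i)) ->
  measurable_fun setT (fun w => has (p ^~ w) s).
Proof.
elim: s => [|i s IH] mp /=; first exact: measurable_cst.
apply: measurable_or; first by apply: mp; rewrite mem_head.
by apply: IH => j sj; apply: mp; rewrite inE sj orbT.
Qed.

Lemma measurable_all (I : eqType) (s : seq I) (p : I -> T -> bool) :
  (forall i, i \in s -> measurable_fun setT (p i)) ->
  measurable_fun setT (fun w => all (p ^~ w) s).
Proof.
elim: s => [|i s IH] mp /=; first exact: measurable_cst.
apply: measurable_and; first by apply: mp; rewrite mem_head.
by apply: IH => j sj; apply: mp; rewrite inE sj orbT.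
Qed.

Lemma measurable_meeting_time X V i j :
  measurable_fun setT (fun w => X j w - X i w) ->
  measurable_fun setT (V i) -> measurable_fun setT (V j) ->
  measurable_fun setT (fun w => meeting_time (X ^~ w) (V ^~ w) i j).
Proof.
move=> mX mi mj; rewrite /meeting_time.
have mq : measurable_fun setT (fun w => (X j w - X i w) / (V i w - V j w)).
  apply: measurable_funM => //.
  by apply: (measurableT_comp measurable_inv); exact: measurable_funB.
apply: measurable_fun_ifT; last exact: measurable_cst.
  apply: measurable_and; first by apply: measurable_neg; exact: measurable_fun_eqr.
  by apply: measurable_fun_ler.
exact/measurable_EFinP.
Qed.

Lemma measurable_removal_time X V n s i : i \in s ->
  (forall j k, j \in s -> k \in s -> measurable_fun setT (fun w => X k w - X j w)) ->
  (forall j, j \in s -> measurable_fun setT (V j)) ->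
  measurable_fun setT (fun w => removal_time n s (X ^~ w) (V ^~ w) i).
Proof.
elim: n s => [|n IH] s si mX mV /=; first exact: measurable_cst.
have mm j k : j \in s -> k \in s ->
    measurable_fun setT (fun w => meeting_time (X ^~ w) (V ^~ w) j k).
  by move=> sj sk; apply: measurable_meeting_time; auto.
have mf : measurable_fun setT (fun w => first_meeting (X ^~ w) (V ^~ w) s).
  by apply: measurable_bigmine => j sj; apply: measurable_bigmine => k sk; exact: mm.
have mfirst j : j \in s -> measurable_fun setT (fun w => meets_first (X ^~ w) (V ^~ w) s j).
  move=> sj; apply: (measurable_has (p := fun k w =>
    meeting_time (X ^~ w) (V ^~ w) j k == first_meeting (X ^~ w) (V ^~ w) s)) => k sk.
  by apply: measurable_fun_eqe => //; exact: mm.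
(* The induction hypothesis is about lists containing [i]; the default 0 for the others gives a
   function measurable for every fixed sublist. *)
have -> : (fun w => if meets_first (X ^~ w) (V ^~ w) s i then first_meeting (X ^~ w) (V ^~ w) s
    else removal_time n [seq j <- s | ~~ meets_first (X ^~ w) (V ^~ w) s j] (X ^~ w) (V ^~ w) i)
  = (fun w => if meets_first (X ^~ w) (V ^~ w) s i then first_meeting (X ^~ w) (V ^~ w) s else
      (fun l w => if i \in l then removal_time n l (X ^~ w) (V ^~ w) i else 0%E)
        [seq j <- s | ~~ meets_first (X ^~ w) (V ^~ w) s j] w).
  by apply/funext => w; case: ifPn => // ni; rewrite /= mem_filter ni si.
apply: measurable_fun_ifT => //; first exact: mfirst.
apply: (measurable_filter (p := fun j w => ~~ meets_first (X ^~ w) (V ^~ w) s j)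
  (F := fun l w => if i \in l then removal_time n l (X ^~ w) (V ^~ w) i else 0%E)).
  by move=> j sj; apply: measurable_neg; exact: mfirst.
move=> l ls /=; have [li|_] := boolP (i \in l); last exact: measurable_cst.
apply: IH => //; first by move=> j k /ls sj /ls sk; exact: mX.
by move=> j /ls sj; exact: mV.
Qed.

(** Only gaps are assumed measurable: the lemma will be used for sigma-algebras generated by some
    gaps, which do not determine the positions themselves. *)
Lemma measurable_increment X a n :
  (forall k, a <= k < a + n%:Z -> measurable_fun setT (fun w => X (k + 1) w - X k w)) ->
  forall i j, a <= i <= a + n%:Z -> a <= j <= a + n%:Z ->
    measurable_fun setT (fun w => X j w - X i w).
Proof.
move=> mg.
have H m : (m <= n)%N -> measurable_fun setT (fun w => X (a + m%:Z) w - X a w).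
  elim: m => [|m IH] mn.
    by under eq_fun do rewrite addr0 subrr; exact: measurable_cst.
  have -> : (fun w => X (a + m.+1%:Z) w - X a w) =
      (fun w => (X (a + m%:Z + 1) w - X (a + m%:Z) w) + (X (a + m%:Z) w - X a w)).
    have -> : a + m.+1%:Z = a + m%:Z + 1 by int_lia.
    by apply/funext => w; ring.
  by apply: measurable_funD; [apply: mg|apply: IH]; int_lia.
have H' i : a <= i <= a + n%:Z -> measurable_fun setT (fun w => X i w - X a w).
  move=> ia; have iE : i = a + `|i - a|%N%:Z by int_lia.
  by rewrite iE; apply: H; int_lia.
move=> i j ia ja.
have -> : (fun w => X j w - X i w) = (fun w => (X j w - X a w) - (X i w - X a w)).
  by apply/funext => w; ring.
by apply: measurable_funB; exact: H'.
Qed.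

Lemma measurable_window_time X V a n i : a <= i <= a + n%:Z ->
  (forall k, a <= k < a + n%:Z -> measurable_fun setT (fun w => X (k + 1) w - X k w)) ->
  (forall k, a <= k <= a + n%:Z -> measurable_fun setT (V k)) ->
  measurable_fun setT (fun w => window_time (X ^~ w) (V ^~ w) a n i).
Proof.
move=> ia mX mV; apply: measurable_removal_time; first by rewrite mem_window.
  by move=> j k; rewrite !mem_window => ja ka; exact: (measurable_increment mX).
by move=> j; rewrite mem_window; exact: mV.
Qed.

Lemma measurable_meet X V a n :
  (forall k, a <= k < a + n%:Z -> measurable_fun setT (fun w => X (k + 1) w - X k w)) ->
  (forall k, a <= k <= a + n%:Z -> measurable_fun setT (V k)) ->
  measurable_fun setT (fun w => meet (X ^~ w) (V ^~ w) a n).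
Proof.
move=> mX mV; rewrite /meet.
have mm : measurable_fun setT (fun w => meeting_time (X ^~ w) (V ^~ w) a (a + n%:Z)).
  apply: measurable_meeting_time; [|by apply: mV; int_lia|by apply: mV; int_lia].
  by apply: (measurable_increment mX); int_lia.
by do !apply: measurable_and; do ?apply: measurable_neg;
  apply: measurable_fun_eqe => //; apply: measurable_window_time => //; int_lia.
Qed.

Lemma measurable_hit c X V a n :
  (forall k, a <= k < a + n%:Z -> measurable_fun setT (fun w => X (k + 1) w - X k w)) ->
  (forall k, a < k <= a + n%:Z -> measurable_fun setT (V k)) ->
  measurable_fun setT (fun w => hit c (X ^~ w) (V ^~ w) a n).
Proof.
move=> mX mV; rewrite /hit.
apply: (@measurable_meet X (fun k w => if k == a then c else V k w)) => // k ka.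
case: eqP => [_|nka]; first exact: measurable_cst.
by apply: mV; int_lia.
Qed.

End measurability.

Section relabelling.
Context {R : realType}.
Implicit Types (x v : int -> R).

Lemma removal_time_map (f : int -> int) n s x v x' v' :
  (forall i j, i \in s -> j \in s ->
    meeting_time x v (f i) (f j) = meeting_time x' v' i j) ->
  forall i, i \in s -> removal_time n (map f s) x v (f i) = removal_time n s x' v' i.
Proof.
elim: n s => [|n IH] s E i si //=.
have Em : first_meeting x v (map f s) = first_meeting x' v' s.
  rewrite /first_meeting big_map; apply: eq_big_seq => j sj.
  by rewrite big_map; apply: eq_big_seq => k sk; exact: E.
have Ef j : j \in s -> meets_first x v (map f s) (f j) = meets_first x' v' s j.
  move=> sj; rewrite /meets_first has_map Em; apply: eq_in_has => k sk /=.
  by rewrite E.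
rewrite Ef// Em; case: ifPn => // ni; rewrite filter_map.
have -> : [seq j <- s | preim f (fun j => ~~ meets_first x v (map f s) j) j] =
    [seq j <- s | ~~ meets_first x' v' s j].
  by apply: eq_in_filter => j sj /=; rewrite Ef.
apply: IH; last by rewrite mem_filter ni.
by move=> j k; rewrite !mem_filter => /andP[_ sj] /andP[_ sk]; exact: E.
Qed.

Lemma meet_shift a n x v x' v' :
  (forall i j, 0 <= i <= n%:Z -> 0 <= j <= n%:Z ->
    x (a + j) - x (a + i) = x' j - x' i) ->
  (forall i, 0 <= i <= n%:Z -> v (a + i) = v' i) ->
  meet x v a n = meet x' v' 0 n.
Proof.
move=> Ex Ev.
have Et i j : 0 <= i <= n%:Z -> 0 <= j <= n%:Z ->
    meeting_time x v (a + i) (a + j) = meeting_time x' v' i j.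
  by move=> ni nj; rewrite /meeting_time Ex// !Ev.
have Ew i : 0 <= i <= n%:Z -> window_time x v a n (a + i) = window_time x' v' 0 n i.
  move=> ni; rewrite /window_time.
  have -> : window a n = map (fun k => a + k) (window 0 n).
    by rewrite -map_comp; apply: eq_map => k /=; rewrite add0r.
  apply: (@removal_time_map (fun k => a + k)); last by rewrite mem_window add0r.
  by move=> k j; rewrite !mem_window add0r; exact: Et.
have n0 : 0 <= (0 : int) <= n%:Z by int_lia.
have nn : 0 <= n%:Z <= n%:Z by int_lia.
by rewrite /meet add0r -(Ew _ n0) -(Ew _ nn) -(Et _ _ n0 nn) addr0.
Qed.

Lemma hit_shift c a n x v x' v' :
  (forall i j, 0 <= i <= n%:Z -> 0 <= j <= n%:Z ->
    x (a + j) - x (a + i) = x' j - x' i) ->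
  (forall i, 0 < i <= n%:Z -> v (a + i) = v' i) ->
  hit c x v a n = hit c x' v' 0 n.
Proof.
move=> Ex Ev; apply: meet_shift => // i ni; rewrite /set_speed.
have -> : (a + i == a) = (i == 0) by rewrite -[X in _ == X]addr0 (inj_eq (addrI a)).
by case: eqP => // i0; apply: Ev; int_lia.
Qed.

End relabelling.

(** * Re-indexing of independent families and the first-passage bound *)

Section transfer.
Context {R : realType} {d : measure_display} {T : measurableType d}.
Variable P : probability T R.

Lemma mutually_independent_image (I I' : choiceType) (X : I -> T -> R)
    (Y : I' -> T -> R) (f : I' -> I) (g : I -> I') (phi : I' -> R -> R) :
  cancel f g -> (forall i, measurable_fun setT (phi i)) ->
  (forall i w, Y i w = phi i (X (f i) w)) ->
  mutually_independent P X -> mutually_independent P Y.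
Proof.
move=> fK mphi YX ind J B mB.
pose B' i := phi (g i) @^-1` B (g i).
have mB' i : measurable (B' i) by rewrite -[B' i]setTI; exact: mphi.
have YE i : Y i @^-1` B i = X (f i) @^-1` B' (f i).
  by apply/seteqP; split=> w; rewrite /B' /= fK YX.
transitivity (P (\bigcap_(i in [set` (f @` J)%fset]) (X i @^-1` B' i))).
  congr (P _); apply/seteqP; split=> w H i /=.
    by case/imfsetP => j /= jJ ->; have := H j jJ; rewrite YE.
  move=> iJ; have : (X (f i) @^-1` B' (f i)) w by apply: H; rewrite /= in_imfset.
  by rewrite -YE.
rewrite ind// big_imfset /=; last by move=> i j _ _; exact: can_inj.
by apply: eq_bigr => i _; rewrite YE.
Qed.

Lemma le_probability_ae (A B : set T) : measurable A -> measurable B ->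
  {ae P, forall w, A w -> B w} -> (P A <= P B)%E.
Proof.
move=> mA mB AB.
have : P (A `\` B) = 0%E.
  apply: measure_negligible; first exact: measurableD.
  by apply: negligibleS AB => w /= [Aw nB] /(_ Aw).
move=> E0; rewrite -[leRHS](measureU0 mB (measurableD mA mB) E0).
apply: le_measure; rewrite ?inE//.
  by apply: measurableU => //; exact: measurableD.
by move=> w Aw; have [Bw|nB] := pselect (B w); [left|right].
Qed.

Lemma ae_all_int (Q : int -> T -> Prop) : (forall k, {ae P, forall w, Q k w}) ->
  {ae P, forall w, forall k, Q k w}.
Proof.
move=> H.
have H1 : {ae P, forall w, forall n : nat, Q n%:Z w} by apply: ae_foralln => n; exact: H.
have H2 : {ae P, forall w, forall n : nat, Q (Negz n) w} by apply: ae_foralln => n; exact: H.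
by apply: filterS2 H1 H2 => w h1 h2 [n|n]; [exact: h1|exact: h2].
Qed.

(* [D k] says that a search stops at step [k]; afterwards [B k] has probability [q]. *)
Lemma first_passage n (D B : nat -> set T) (W U : set T) (q : \bar R) :
  (forall k, measurable (D k)) -> (forall k, measurable (B k)) ->
  measurable W -> measurable U -> trivIset setT D -> (forall k, (k < n)%N -> D k `<=` U) ->
  (0 <= q)%E -> (forall k, (k < n)%N -> P (D k `&` B k) = (P (D k) * q)%E) ->
  {ae P, forall w, W w -> exists k, [/\ (k < n)%N, D k w & B k w]} ->
  (P W <= P U * q)%E.
Proof.
move=> mD mB mW mU tD DU q0 E ae.
have mDB k : measurable (D k `&` B k) by exact: measurableI.
have mBU : measurable (\big[setU/set0]_(k < n) D k) by exact: bigsetU_measurable.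
apply: (@le_trans _ _ (P (\big[setU/set0]_(k < n) (D k `&` B k)))).
  apply: le_probability_ae => //; first exact: bigsetU_measurable.
  apply: filterS ae => w H /H[k [kn Dk Bk]].
  suff : (\bigcup_(k < n) (D k `&` B k)) w by rewrite bigcup_mkord.
  by exists k.
apply: le_trans; first exact: (@Boole_inequality _ _ _ P (fun k => D k `&` B k)).
rewrite (eq_bigr (fun k : 'I_n => P (D k) * q)%E); last by move=> k _; exact: E.
rewrite -ge0_sume_distrl//.
rewrite -measure_semi_additive_ord//.
- rewrite lee_wpmul2r// le_measure ?inE//.
  by rewrite -bigcup_mkord; apply: bigcup_sub => k; exact: DU.
- by apply/trivIsetP => i j _ _ ij; move/trivIsetP : tD; apply.
Qed.

End transfer.

(** * The one-sided hitting probability *)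

Section hit_within.
Context {R : realType}.
Implicit Types (x v : int -> R).

Definition hit_within (c : R) x v a n : bool := has (hit c x v a) (iota 0 n.+1).

(** A stopping rule: it inspects the particles 1, ..., 1 + k only. It is used with [m = 0] in
    general and [m = 2M + 2] on the pattern, where the collision in the reduced system must be
    skipped. *)
Definition first_meet_after m x v k : bool :=
  [&& (m < k)%N, meet x v 1 k
    & ~~ has (fun j => (m < j)%N && meet x v 1 j) (iota 0 k)].

Lemma hit_withinP c x v a n :
  reflect (exists2 l, (l <= n)%N & hit c x v a l) (hit_within c x v a n).
Proof.
apply: (iffP hasP) => -[l ln hl]; exists l => //.
  by move: ln; rewrite mem_iota.
by rewrite mem_iota.
Qed.

Lemma hit_within_le c x v a n m : (n <= m)%N ->
  hit_within c x v a n -> hit_within c x v a m.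
Proof.
move=> nm /hit_withinP[l ln hl]; apply/hit_withinP; exists l => //.
exact: leq_trans nm.
Qed.

Lemma first_meet_after_exists m x v j : (m < j)%N -> meet x v 1 j ->
  exists k, (k <= j)%N /\ first_meet_after m x v k.
Proof.
move=> mj hj.
have ex : exists k, (m < k)%N && meet x v 1 k by exists j; rewrite mj.
case: (ex_minnP ex) => k /andP[mk hk] kmin; exists k; split.
  by apply: kmin; rewrite mj.
rewrite /first_meet_after mk hk /=; apply/hasPn => l; rewrite mem_iota add0n => /andP[_ lk].
by apply/negP => /kmin; rewrite leqNgt lk.
Qed.

Lemma first_meet_after_uniq m x v k l :
  first_meet_after m x v k -> first_meet_after m x v l -> k = l.
Proof.
have H k' l' : first_meet_after m x v k' -> first_meet_after m x v l' -> ~~ (k' < l')%N.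
  move=> /and3P[mk hk _] /and3P[_ _ /hasPn nl]; apply/negP => kl.
  have : k' \in iota 0 l' by rewrite mem_iota.
  by move/nl; rewrite mk hk.
by move=> hk hl; have := H _ _ hk hl; have := H _ _ hl hk; rewrite -!leqNgt; int_lia.
Qed.

Lemma measurable_hit_within d (T : measurableType d) c (X V : int -> T -> R) a n :
  (forall k, a <= k -> measurable_fun setT (fun w => X (k + 1) w - X k w)) ->
  (forall k, a < k -> measurable_fun setT (V k)) ->
  measurable_fun setT (fun w => hit_within c (X ^~ w) (V ^~ w) a n).
Proof.
move=> mX mV; apply: (measurable_has (p := fun l w => hit c (X ^~ w) (V ^~ w) a l)) => l _.
apply: measurable_hit => k /andP[ak _]; [exact: mX|exact: mV].
Qed.

Lemma measurable_first_meet_after d (T : measurableType d) m (X V : int -> T -> R) k :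
  (forall j, 1 <= j < 1 + k%:Z -> measurable_fun setT (fun w => X (j + 1) w - X j w)) ->
  (forall j, 1 <= j <= 1 + k%:Z -> measurable_fun setT (V j)) ->
  measurable_fun setT (fun w => first_meet_after m (X ^~ w) (V ^~ w) k).
Proof.
move=> mX mV; rewrite /first_meet_after.
have mm j : (j <= k)%N -> measurable_fun setT (fun w => meet (X ^~ w) (V ^~ w) 1 j).
  by move=> jk; apply: measurable_meet => i ij; [apply: mX|apply: mV]; int_lia.
apply: measurable_and; first exact: measurable_cst.
apply: measurable_and; first exact: mm.
apply: measurable_neg.
apply: (measurable_has (p := fun j w => (m < j)%N && meet (X ^~ w) (V ^~ w) 1 j)) => j.
rewrite mem_iota add0n => /andP[_ jk]; apply: measurable_and; first exact: measurable_cst.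
by apply: mm; exact: ltnW.
Qed.

End hit_within.

Definition increment {R : realType} {T : Type} (X : int -> T -> R) (k : int) (w : T) : R :=
  X (k + 1) w - X k w.

Definition increments_speeds {R : realType} {T : Type} (X V : int -> T -> R)
    (i : int + int) : T -> R :=
  match i with inl k => increment X k | inr k => V k end.

(* [inl k] stands for the gap between [k] and [k + 1], [inr k] for the speed of [k]. *)
Definition after (a : int) : set (int + int) :=
  [set i | match i with inl k => a <= k | inr k => a < k end].

(** The speed of [a] belongs to the past and the gap to its right to the future: a stop at [a] uses
    the former, while a hit of [a] overwrites it. *)
Definition before (a : int) : set (int + int) :=
  [set i | match i with inl k => 1 <= k < a | inr k => 1 <= k <= a end].

Section one_sided.
Context {R : realType} {d : measure_display} {T : measurableType d}.
Variables (P : probability T R) (r1 r2 r3 : R) (X V : int -> T -> R).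
Hypotheses (hr32 : r3 < r2) (hr21 : r2 < r1).

Local Notation gap := (increment X).
Local Notation family := (increments_speeds X V).

Hypothesis mX : forall k, measurable_fun setT (X k).
Hypothesis mV : forall k, measurable_fun setT (V k).
Hypothesis indep : mutually_independent P family.
Hypothesis law_V : forall k, has_law P (V k) (uniform_on [:: r3; r2; r1]).
Hypothesis law_gap : forall k B, measurable B -> P (gap k @^-1` B) = P (gap 0 @^-1` B).
Hypothesis gap_pos : {ae P, forall w, 0 < gap 0 w}.
Hypothesis gap_ge1 : (0 < P (gap 0%R @^-1` `[1%R, +oo[))%E.
Hypothesis gap_le1 : (0 < P (gap 0%R @^-1` `]-oo, 1%R]))%E.

Lemma measurable_family i : measurable_fun setT (family i).
Proof. by case: i => k //=; exact: measurable_funB. Qed.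

Definition hits a n : set T := [set w | hit_within r2 (X ^~ w) (V ^~ w) a n].
Definition first_meets m k : set T := [set w | first_meet_after m (X ^~ w) (V ^~ w) k].
Definition speed k c : set T := V k @^-1` [set c].

Lemma sigma_event D (f : T -> bool) :
  measurable_fun setT (f : g_sigma_algebraType (rectangles family D) -> bool) ->
  <<s rectangles family D >> [set w | f w].
Proof.
move=> mf; have := mf measurableT [set true] I; rewrite setTI.
by congr (<<s _ >> _); apply/seteqP; split=> w /=; case: (f w).
Qed.

Lemma sigma_hits a n : <<s rectangles family (after a) >> (hits a n).
Proof.
apply: (sigma_event (f := fun w => hit_within r2 (X ^~ w) (V ^~ w) a n)).
apply: (@measurable_hit_within _ _ (g_sigma_algebraType (rectangles family (after a)))).
  by move=> k ak; exact: (measurable_coordinate (X := family) (i := inl k)).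
by move=> k ak; exact: (measurable_coordinate (X := family) (i := inr k)).
Qed.

Lemma sigma_first_meets m k : <<s rectangles family (before (1 + k%:Z)) >> (first_meets m k).
Proof.
apply: (sigma_event (f := fun w => first_meet_after m (X ^~ w) (V ^~ w) k)).
apply: (@measurable_first_meet_after _ _ (g_sigma_algebraType (rectangles family (before (1 + k%:Z))))).
  by move=> j jk; exact: (measurable_coordinate (X := family) (i := inl j)).
by move=> j jk; exact: (measurable_coordinate (X := family) (i := inr j)).
Qed.

Lemma sigma_speed (D : set (int + int)) k c : D (inr k) -> <<s rectangles family D >> (speed k c).
Proof.
move=> Dk.
have := measurable_coordinate (X := family) Dk measurableT (measurable_set1 c).
by rewrite setTI.
Qed.

Lemma sigma_measurable D A : <<s rectangles family D >> A -> measurable A.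
Proof. exact: (measurable_sigma_rectangles measurable_family). Qed.

Lemma measurable_hits a n : measurable (hits a n).
Proof. exact: (sigma_measurable (@sigma_hits a n)). Qed.

Lemma measurable_first_meets m k : measurable (first_meets m k).
Proof. exact: (sigma_measurable (@sigma_first_meets m k)). Qed.

Lemma measurable_speed k c : measurable (speed k c).
Proof. by rewrite -[speed k c]setTI; exact: mV. Qed.

Lemma probability_speed k c : c \in [:: r3; r2; r1] -> P (speed k c) = (3^-1)%:E.
Proof.
move=> cr; rewrite [P _]law_V; last exact: measurable_set1.
rewrite /uniform_on /= !big_cons big_nil !diracE adde0.
have r23 : r3 != r2 by rewrite lt_eqF.
have r12 : r2 != r1 by rewrite lt_eqF.
have r13 : r3 != r1 by rewrite lt_eqF// (lt_trans hr32).
have E a : a \in [set c] = (a == c).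
  by apply/idP/eqP; rewrite inE.
rewrite !E -!EFinD -EFinM; congr (_%:E).
move: cr; rewrite !inE => /or3P[]/eqP->; rewrite ?eqxx ?(negbTE r23) ?(negbTE r12) ?(negbTE r13)
  ?[r2 == r3]eq_sym ?[r1 == r2]eq_sym ?[r1 == r3]eq_sym ?(negbTE r23) ?(negbTE r12) ?(negbTE r13) /=;
  by rewrite ?addr0 ?add0r mulr1.
Qed.

Lemma speeds_ae : {ae P, forall w, forall k, V k w \in [:: r3; r2; r1]}.
Proof.
apply: ae_all_int => k.
pose A := speed k r3 `|` (speed k r2 `|` speed k r1).
have mA : measurable A by do !apply: measurableU; exact: measurable_speed.
have disj c c' : c < c' -> speed k c `&` speed k c' = set0.
  by move=> cc; apply/seteqP; split=> w // [E1 E2]; move: cc; rewrite -E1 -E2 ltxx.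
have PA : P A = 1%E.
  have m c : measurable (speed k c) := measurable_speed k c.
  have -> : P A = (P (speed k r3) + (P (speed k r2) + P (speed k r1)))%E.
    rewrite /A measureU//; first by rewrite measureU// disj.
      by apply: measurableU.
    by rewrite setIUr !disj ?setU0// (lt_trans hr32).
  rewrite !probability_speed ?inE ?eqxx ?orbT//.
  by rewrite -!EFinD; congr (_%:E); lra.
exists (~` A); split; first exact: measurableC.
  by rewrite probability_setC// PA subee.
move=> w /= H; apply: contra_not H => -[|[]] /= ->; by rewrite !inE eqxx ?orbT.
Qed.

Lemma gaps_pos_ae : {ae P, forall w, forall k, 0 < gap k w}.
Proof.
apply: ae_all_int => k.
have mB : measurable (`]-oo, 0] : set R) by exact: measurable_itv.
have mg j : measurable (gap j @^-1` `]-oo, 0]).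
  by rewrite -[_ @^-1` _]setTI; apply: (measurable_family (inl j)).
exists (gap k @^-1` `]-oo, 0]); split => //.
  rewrite law_gap//; apply: measure_negligible => //.
  by apply: negligibleS gap_pos => w /=; rewrite in_itv /= leNgt => /negP.
by move=> w /= /negP; rewrite -leNgt in_itv.
Qed.

Lemma good_ae : {ae P, forall w, (forall i j, i < j -> X i w < X j w) /\
  forall k, V k w \in [:: r3; r2; r1]}.
Proof.
apply: filterS2 gaps_pos_ae speeds_ae => w g v; split=> // i j ij.
have H m : X i w < X (i + m.+1%:Z) w.
  elim: m => [|m IH]; first by have := g i; rewrite /increment subr_gt0.
  apply: lt_trans IH _; have := g (i + m.+1%:Z).
  have -> : i + m.+2%:Z = i + m.+1%:Z + 1 by int_lia.
  by rewrite /increment subr_gt0.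
have -> : j = i + `|j - i|%N.-1.+1%:Z by int_lia.
exact: H.
Qed.

Let shift a (i : int + int) : int + int :=
  match i with inl k => inl (a + k) | inr k => inr (a + k) end.

Lemma hits_stationary a n : P (hits a n) = P (hits 0 n).
Proof.
(* Positions relative to the base point, rebuilt from the gaps; the windows in question start at 0,
   so negative indices get a default value. *)
pose pos (f : int + int -> R) (i : int) : R :=
  if i is Posz m then \sum_(j < m) f (inl j%:Z) else 0.
pose S := [set f : int + int -> R | hit_within r2 (pos f) (fun k => f (inr k)) 0 n].
have sS : <<s rectangles (fun i (f : int + int -> R) => f i) setT >> S.
  pose Y i (f : int + int -> R) := f i.
  have mY i : measurable_fun setT (Y i : g_sigma_algebraType (rectangles Y setT) -> R).
    exact: (measurable_coordinate (X := Y)).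
  have := @measurable_hit_within _ _ (g_sigma_algebraType (rectangles Y setT)) r2
    (fun k f => pos f k) (fun k f => f (inr k)) 0 n.
  move=> /(_ _ _ measurableT [set true] I); rewrite setTI; apply.
    case=> // k _; have -> : (fun f => pos f (Posz k + 1) - pos f (Posz k)) = Y (inl k%:Z).
      apply/funext => f; have -> : Posz k + 1 = Posz k.+1 by int_lia.
      by rewrite /pos big_ord_recr /= addrAC subrr add0r.
    exact: mY.
  by move=> k _; exact: (mY (inr k)).
have hitsE b : hits b n = [set w | S ((fun i => family (shift b i)) ^~ w)].
  have E w l : hit r2 (X ^~ w) (V ^~ w) b l =
      hit r2 (pos (fun i => family (shift b i) w)) (fun k => family (shift b (inr k)) w) 0 l.
    apply: hit_shift => // i j /andP[i0 _] /andP[j0 _].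
    have posE k : 0 <= k -> pos (fun i => family (shift b i) w) k = X (b + k) w - X b w.
      case: k => // m _; rewrite /pos; elim: m => [|m IH].
        by rewrite big_ord0 addr0 subrr.
      rewrite big_ord_recr IH /= /increment.
      have -> : b + Posz m.+1 = b + Posz m + 1 by int_lia.
      by ring.
    by rewrite !posE//; ring.
  by apply/funext => w; rewrite /hits /S /hit_within /= (eq_has (E w)) (E w).
rewrite !hitsE; apply: law_unique sS.
- by move=> i; exact: measurable_family.
- by move=> i; exact: measurable_family.
move=> J B mB.
have ind b : mutually_independent P (fun i => family (shift b i)).
  apply: (@mutually_independent_image _ _ _ P _ _ family _ (shift b) (shift (- b)) (fun _ => id)) => //.
  by case=> k /=; congr (_ _); ring.
rewrite (ind a J B mB) (ind 0 J B mB); apply: eq_bigr => -[k|k] _ /=.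
  by rewrite law_gap// [RHS]law_gap.
by rewrite !law_V.
Qed.

Lemma stop_then_hit (A : set T) k n : <<s rectangles family (before (1 + k%:Z)) >> A ->
  P (A `&` hits (1 + k%:Z) n) = (P A * P (hits 0 n))%E.
Proof.
move=> sA; rewrite -(hits_stationary (1 + k%:Z) n).
apply: (sigma_rectangles_independent measurable_family indep _ sA (@sigma_hits _ n)).
by case=> j /=; int_lia.
Qed.

(** The stop [k] need not give the actual partner of 1 in the larger window: [hit_after_meet]
    applies whenever 1 and [1 + k] annihilate in their own window, so the first such [k] after [m]
    may be taken. *)
Lemma hit_then_stop x v m n l j : (forall i j, i < j -> x i < x j) ->
  (forall k : int, v k \in [:: r3; r2; r1]) -> v 1 != r3 -> (l <= n.+1)%N ->
  hit r2 x v 0 l -> (m < j)%N -> (1 + j < l)%N -> meet x v 1 j ->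
  exists k, [/\ (k < n.+1)%N, first_meet_after m x v k & hit_within r2 x v (1 + k%:Z) n].
Proof.
move=> x_incr vin v1 ln hl mj jl mt.
have [k [kj hk]] := first_meet_after_exists mj mt; exists k; split=> //.
  by int_lia.
have /and3P[_ mk _] := hk.
have [|l' [le_l hl']] := hit_after_meet x_incr hr32 hr21 vin v1 hl _ mk.
  exact: leq_ltn_trans jl.
by apply/hit_withinP; exists l' => //; int_lia.
Qed.

Lemma trivIset_first_meets m (A : set T) : trivIset setT (fun k => A `&` first_meets m k).
Proof.
apply/trivIsetP => i j _ _ ij; apply/seteqP; split=> // w [[_ hi] [_ hj]].
by move: ij; rewrite (first_meet_after_uniq hi hj) eqxx.
Qed.

Lemma ge0_probability (A : set T) : (0 <= P A)%E. Proof. exact: measure_ge0. Qed.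

Lemma middle_first n :
  (P (speed 1 r2 `&` hits 0 n.+1) <= P (speed 1 r2) * P (hits 0 n) * P (hits 0 n))%E.
Proof.
have ind : P (speed 1 r2 `&` hits 1 n) = (P (speed 1 r2) * P (hits 0 n))%E.
  rewrite -(stop_then_hit (k := 0)) ?addr0//.
  by apply: sigma_speed; rewrite /before /=; int_lia.
rewrite -ind.
apply: (@first_passage _ _ _ P n.+1 (fun k => speed 1 r2 `&` first_meets 0 k)
  (fun k => hits (1 + k%:Z) n)).
- by move=> k; apply: measurableI; [exact: measurable_speed|exact: measurable_first_meets].
- by move=> k; exact: measurable_hits.
- by apply: measurableI; [exact: measurable_speed|exact: measurable_hits].
- by apply: measurableI; [exact: measurable_speed|exact: measurable_hits].
- exact: trivIset_first_meets.
(* When 1 is static, overwriting its speed changes nothing, so a stop is the same as a hit of 1. *)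
- move=> k kn w [v1 /and3P[_ mk _]]; split=> //; apply/hit_withinP; exists k => //.
  rewrite /hit; have -> // : set_speed r2 (V ^~ w) 1 = V ^~ w.
  by apply/funext => i; rewrite /set_speed; case: eqP => // ->.
- exact: ge0_probability.
- move=> k _; apply: stop_then_hit; apply: sigma_rectanglesI; last exact: sigma_first_meets.
  by apply: sigma_speed; rewrite /before /=; int_lia.
- apply: filterS good_ae => w [x_incr vin] [v1 /hit_withinP[l ln hl]].
  have v1' : V 1 w != r3 by rewrite v1 gt_eqF.
  have [j [j0 jl mj]] := hit_first_meet x_incr hr32 hr21 vin v1' hl.
  by have [k [kn fk hk]] := hit_then_stop x_incr vin v1' ln hl j0 jl mj; exists k.
Qed.

(** Kept as an event rather than a bound, because the pattern has to be cut out of it in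
    [hits_recursion]. *)
Definition fast_first n : set T :=
  \bigcup_(k < n.+1) (speed 1 r1 `&` first_meets 0 k `&` hits (1 + k%:Z) n).

Lemma measurable_fast_first n : measurable (fast_first n).
Proof.
apply: fin_bigcup_measurable => // k _; apply: measurableI; last exact: measurable_hits.
by apply: measurableI; [exact: measurable_speed|exact: measurable_first_meets].
Qed.

Lemma probability_fast_first n :
  (P (fast_first n) <= P (speed 1 r1) * P (hits 0 n))%E.
Proof.
apply: (@first_passage _ _ _ P n.+1 (fun k => speed 1 r1 `&` first_meets 0 k)
  (fun k => hits (1 + k%:Z) n)).
- by move=> k; apply: measurableI; [exact: measurable_speed|exact: measurable_first_meets].
- by move=> k; exact: measurable_hits.
- exact: measurable_fast_first.
- exact: measurable_speed.
- exact: trivIset_first_meets.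
- by move=> k kn w [].
- exact: ge0_probability.
- move=> k _; apply: stop_then_hit; apply: sigma_rectanglesI; last exact: sigma_first_meets.
  by apply: sigma_speed; rewrite /before /=; int_lia.
- by apply: filterS good_ae => w _ [k kn [? ?]]; exists k.
Qed.

Definition pattern_event M : set T := [set w |
  [&& all (fun j : nat => V j%:Z w == pattern_speed r1 r2 r3 M j) (iota 1 (2 * M + 3)),
      all (fun j : nat => 1 <= gap j%:Z w) (iota 1 (2 * M + 1)) & gap (2 * M + 2)%:Z w <= 1]].

Lemma sigma_pattern_event M k : (2 * M + 2 < k)%N ->
  <<s rectangles family (before (1 + k%:Z)) >> (pattern_event M).
Proof.
move=> Mk; apply: (sigma_event (f := fun w => [&& _, _ & _])).
have mg j : 1 <= j < 1 + k%:Z ->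
    measurable_fun setT (gap j : g_sigma_algebraType (rectangles family (before (1 + k%:Z))) -> R).
  by move=> jk; exact: (measurable_coordinate (X := family) (i := inl j)).
have mv j : 1 <= j <= 1 + k%:Z ->
    measurable_fun setT (V j : g_sigma_algebraType (rectangles family (before (1 + k%:Z))) -> R).
  by move=> jk; exact: (measurable_coordinate (X := family) (i := inr j)).
apply: measurable_and; last (apply: measurable_and).
- apply: (@measurable_all _ (g_sigma_algebraType (rectangles family (before (1 + k%:Z)))) nat _
    (fun (j : nat) w => V j%:Z w == pattern_speed r1 r2 r3 M j)) => j.
  rewrite mem_iota => jM; apply: measurable_fun_eqr => //.
  by apply: mv; int_lia.
- apply: (@measurable_all _ (g_sigma_algebraType (rectangles family (before (1 + k%:Z)))) nat _
    (fun (j : nat) w => 1 <= gap j%:Z w)) => j.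
  rewrite mem_iota => jM; apply: measurable_fun_ler => //.
  by apply: mg; int_lia.
- by apply: measurable_fun_ler => //; apply: mg; int_lia.
Qed.

Lemma measurable_pattern_event M : measurable (pattern_event M).
Proof. exact: (sigma_measurable (@sigma_pattern_event M _ (ltnSn _))). Qed.

Lemma pattern_eventP M w : pattern_event M w ->
  speed_pattern r1 r2 r3 M (V ^~ w) /\ gap_pattern M (X ^~ w).
Proof.
move=> /and3P[/allP hv /allP hg hl]; split; last split.
- by move=> j jM; apply/eqP; apply: hv; rewrite mem_iota; int_lia.
- by move=> j jM; apply: hg; rewrite mem_iota; int_lia.
- by move: hl; rewrite /increment; have -> : (2 * M + 2)%:Z + 1 = (2 * M + 3)%:Z by int_lia.
Qed.

Lemma pattern_event_gt0 M : (0 < P (pattern_event M))%E.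
Proof.
pose J := [fset i in [seq inl j%:Z | j <- iota 1 (2 * M + 2)] ++
                  [seq inr j%:Z | j <- iota 1 (2 * M + 3)]]%fset : {fset int + int}.
pose B (i : int + int) : set R := match i with
  | inl k => if k <= (2 * M + 1)%:Z then `[1, +oo[%classic else `]-oo, 1]%classic
  | inr k => [set pattern_speed r1 r2 r3 M `|k|%N] end.
have JE i : (i \in J) = (i \in [seq inl j%:Z | j <- iota 1 (2 * M + 2)]) ||
    (i \in [seq inr j%:Z | j <- iota 1 (2 * M + 3)]).
  by rewrite in_fset /= mem_cat.
have mB i : measurable (B i).
  by case: i => k /=; [case: ifP => _; exact: measurable_itv|exact: measurable_set1].
have sub : rectangle family J B `<=` pattern_event M.
  move=> w H; apply/and3P; split.
  - apply/allP => j jM; apply/eqP.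
    have : inr j%:Z \in J by rewrite JE (map_f (fun j : nat => inr j%:Z)) ?orbT.
    by move/H.
  - apply/allP => j jM.
    have : inl j%:Z \in J.
      rewrite JE (map_f (fun j : nat => inl j%:Z))//.
      by move: jM; rewrite !mem_iota; int_lia.
    move/H; rewrite /= ifT; first by rewrite /= in_itv /= andbT.
    by move: jM; rewrite mem_iota; int_lia.
  - have : inl (2 * M + 2)%:Z \in J.
      by rewrite JE (map_f (fun j : nat => inl j%:Z))// mem_iota; int_lia.
    by move/H; rewrite /= ifF; [rewrite /= in_itv|int_lia].
apply: (@lt_le_trans _ _ (P (rectangle family J B))); last first.
  apply: le_measure => //; rewrite inE; last exact: measurable_pattern_event.
  apply: (measurable_rectangles (D := setT) measurable_family).
  by exists J, B; split.
rewrite indep//; elim/big_rec: _ => // i y _ y0; apply: mule_gt0 => //.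
case: i => k /=.
  by rewrite law_gap; [case: ifP|case: ifP => _; exact: measurable_itv].
rewrite -/(speed k _) probability_speed; first by rewrite lte_fin invr_gt0.
by rewrite /pattern_speed !inE; do !case: ifP => _; rewrite eqxx ?orbT.
Qed.

(** The reduced system stops at [2M + 2], and the static particle there is hit by [2M + 3]: the
    crude bound counts the whole pattern. *)
Lemma pattern_event_fast_first M n : (2 * M + 1 < n)%N ->
  {ae P, forall w, pattern_event M w -> fast_first n w}.
Proof.
move=> Mn; apply: filterS good_ae => w [x_incr vin] /pattern_eventP[hv hg].
exists (2 * M + 1)%N; first by rewrite /=; int_lia.
split; first split.
- by rewrite /speed /= (pattern_v1 hv).
- apply/and3P; split; [by int_lia|exact: (pattern_meet hr32 hr21 x_incr vin hv)|].
  apply/hasPn => j; rewrite mem_iota add0n => /andP[_ jM].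
  by rewrite negb_and (pattern_no_early_meet hr32 hr21 x_incr vin hv) ?orbT.
- apply/hit_withinP; exists 1%N; first by int_lia.
  have -> : 1 + (2 * M + 1)%N%:Z = (2 * M + 2)%:Z by int_lia.
  exact: (pattern_hit hr32 hr21 x_incr vin hv).
Qed.

(* The hypothesis on [M] makes particle [2M + 3] reach particle [2M + 2] before particle [1] does. *)
Lemma pattern_event_hits M n : r1 - r2 < (2 * M + 1)%:R * (r2 - r3) ->
  (P (pattern_event M `&` hits 0 n.+1) <= P (pattern_event M) * P (hits 0 n))%E.
Proof.
move=> hM; apply: (@first_passage _ _ _ P n.+1
  (fun k => pattern_event M `&` first_meets (2 * M + 2) k) (fun k => hits (1 + k%:Z) n)).
- move=> k; apply: measurableI; [exact: measurable_pattern_event|exact: measurable_first_meets].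
- by move=> k; exact: measurable_hits.
- by apply: measurableI; [exact: measurable_pattern_event|exact: measurable_hits].
- exact: measurable_pattern_event.
- exact: trivIset_first_meets.
- by move=> k kn w [].
- exact: ge0_probability.
(* For [k] beyond [2M + 2] the whole pattern belongs to the past of the stop; for smaller [k] the
   stop is empty by its definition. *)
- move=> k _; have [Mk|kM] := ltnP (2 * M + 2) k.
    apply: stop_then_hit; apply: sigma_rectanglesI; last exact: sigma_first_meets.
    exact: sigma_pattern_event.
  have -> : first_meets (2 * M + 2) k = set0.
    by apply/seteqP; split=> // w /and3P[]; rewrite ltnNge kM.
  by rewrite setI0 set0I measure0 mul0e.
- apply: filterS good_ae => w [x_incr vin] [pw /hit_withinP[l ln hl]].
  have [hv hg] := pattern_eventP pw.
  have v1 : V 1 w != r3 by rewrite (pattern_v1 hv) gt_eqF// (lt_trans hr32).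
  have [j [j0 jl mj]] := pattern_second_meet hr32 hr21 x_incr hM hg vin hv hl.
  by have [k [kn fk hk]] := hit_then_stop x_incr vin v1 ln hl j0 jl mj; exists k.
Qed.

(** The four contributions are 1/3 for a left-moving particle 1, q^2 / 3 for a static one, at most q
    / 3 - P(E) for [fast_first] without [E], and P(E) q for [E]. The critical recursion is the case
    of empty [E]. *)
Lemma hits_recursion (E : set T) n : measurable E ->
  {ae P, forall w, E w -> fast_first n w} ->
  (P (E `&` hits 0 n.+1) <= P E * P (hits 0 n))%E ->
  fine (P (hits 0 n.+1)) <= (1 + fine (P (hits 0 n)) + fine (P (hits 0 n)) ^+ 2) / 3
    - fine (P E) * (1 - fine (P (hits 0 n))).
Proof.
move=> mE EW le_E; set q := fine (P (hits 0 n)).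
have fE (A : set T) : measurable A -> P A = (fine (P A))%:E.
  by move=> mA; rewrite fineK// fin_num_measure.
have mW := measurable_fast_first n.
have mH m : measurable (hits 0 m) := measurable_hits 0 m.
have mS c : measurable (speed 1 c) := measurable_speed 1 c.
have mSH : measurable (speed 1 r2 `&` hits 0 n.+1) by exact: measurableI.
have mWE : measurable (fast_first n `\` E) by exact: measurableD.
have mEH : measurable (E `&` hits 0 n.+1) by exact: measurableI.
have le1 : (P (hits 0 n.+1) <= P (speed 1 r3) + (P (speed 1 r2 `&` hits 0 n.+1) +
    (P (fast_first n `\` E) + P (E `&` hits 0 n.+1))))%E.
  apply: (@le_trans _ _ (P (speed 1 r3 `|` (speed 1 r2 `&` hits 0 n.+1 `|`
    (fast_first n `\` E `|` (E `&` hits 0 n.+1)))))).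
    apply: le_probability_ae => //; first by do !apply: measurableU.
    apply: filterS good_ae => w [x_incr vin] hw.
    case: (speedsP 1 vin) => v1; [by left|by right; left|right; right].
    have [Ew|nEw] := pselect (E w); [by right|left; split=> //].
    move: (hw) => /hit_withinP[l ln hl].
    have v1' : V 1 w != r3 by rewrite v1 gt_eqF// (lt_trans hr32).
    have [j [j0 jl mj]] := hit_first_meet x_incr hr32 hr21 vin v1' hl.
    by have [k [kn fk hk]] := hit_then_stop x_incr vin v1' ln hl j0 jl mj; exists k.
  apply: le_trans; first by apply: measureU2 => //; do !apply: measurableU.
  rewrite leeD2l//; apply: le_trans; first by apply: measureU2 => //; apply: measurableU.
  by rewrite leeD2l//; apply: measureU2.
have le2 : (P (fast_first n `\` E) + P E <= P (fast_first n))%E.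
  rewrite -measureU//; last by rewrite setDE -setIA setICl setI0.
  apply: le_probability_ae => //; first exact: measurableU.
  by apply: filterS EW => w H [[]|/H].
have in1 : r1 \in [:: r3; r2; r1] by rewrite !inE eqxx !orbT.
have in2 : r2 \in [:: r3; r2; r1] by rewrite !inE eqxx !orbT.
have in3 : r3 \in [:: r3; r2; r1] by rewrite !inE eqxx.
have le3 := probability_fast_first n; have le4 := middle_first n.
move: le1 le2 le3 le4 le_E.
rewrite !probability_speed// (fE _ (mH n.+1)) (fE _ (mH n)) (fE _ mW) (fE _ mSH) (fE _ mWE) (fE _ mEH)
  (fE _ mE) -!EFinM -!EFinD !lee_fin -/q.
by rewrite expr2; lra.
Qed.

Lemma hits_mono n m : (n <= m)%N -> fine (P (hits 0 n)) <= fine (P (hits 0 m)).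
Proof.
move=> nm; apply: fine_le; rewrite ?fin_num_measure//; try exact: measurable_hits.
apply: le_measure; rewrite ?inE; try exact: measurable_hits.
by move=> w; exact: hit_within_le.
Qed.

(** The critical recursion keeps each q_n below 1, though not uniformly in n. *)
Lemma hits_lt1 n : fine (P (hits 0 n)) < 1.
Proof.
elim: n => [|n IH].
  have -> : hits 0 0 = set0.
    apply/seteqP; split=> // w /hit_withinP[l]; rewrite leqn0 => /eqP -> /meet_gt0.
    by rewrite ltnn.
  by rewrite measure0 ltr01.
have := @hits_recursion set0 n measurable0.
rewrite set0I measure0 mul0e /= mul0r subr0 => /(_ _ (lexx _)) H.
apply: le_lt_trans (H _) _; first by apply: aeW => w [].
have : 0 <= fine (P (hits 0 n)) by rewrite fine_ge0.
by rewrite expr2; nra.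
Qed.

Lemma hits_bounded : exists2 delta : R, 0 < delta &
  forall n, (P (hits 0 n) <= (1 - delta)%:E)%E.
Proof.
have r23 : 0 < r2 - r3 by rewrite subr_gt0.
have [M hM] : exists M : nat, r1 - r2 < (2 * M + 1)%:R * (r2 - r3).
  exists (Num.bound ((r1 - r2) / (r2 - r3))); rewrite -ltr_pdivrMr//.
  have r0 : 0 <= (r1 - r2) / (r2 - r3) by rewrite divr_ge0 ?ltW// subr_gt0.
  by apply: lt_le_trans (archi_boundP r0) _; rewrite ler_nat; int_lia.
set e := fine (P (pattern_event M)).
have e0 : 0 < e.
  rewrite fine_gt0// pattern_event_gt0/=.
  by rewrite (le_lt_trans (probability_le1 _ (measurable_pattern_event M)))// ltry.
pose n0 := (2 * M + 2)%N; pose q n := fine (P (hits 0 n)).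
(* [1 - q n0] settles [n <= n0] by monotonicity and starts the induction; [n0 = 2M + 2] is where the
   pattern begins to lie in [fast_first]. The bound by [e] serves the case of a large [1 - Q]
   below. *)
pose delta := Num.min (1 - q n0) e.
have d1 : delta <= 1 - q n0 by rewrite ge_min lexx.
have d2 : delta <= e by rewrite ge_min lexx orbT.
exists delta; first by rewrite lt_min e0 subr_gt0 hits_lt1.
move=> n; rewrite -(fineK (fin_num_measure P _ (measurable_hits 0 n))) lee_fin -/(q n).
have [nn0|n0n] := leqP n n0.
  by have := hits_mono nn0; rewrite -/(q n) -/(q n0); lra.
rewrite -(subnK (ltnW n0n)); elim: (n - n0)%N => [|m IH]; first by rewrite add0n; lra.
rewrite addSn.
have Mm : (2 * M + 1 < m + n0)%N by rewrite /n0; int_lia.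
have := @hits_recursion _ (m + n0) (measurable_pattern_event M)
  (pattern_event_fast_first Mm) (pattern_event_hits (m + n0) hM).
rewrite /= -/(q (m + n0)%N) -/(q (m + n0).+1) -/e expr2 => rec.
have q0 : 0 <= q (m + n0)%N by rewrite fine_ge0.
set Q := q (m + n0)%N in IH rec q0 *.
(* With d = 1 - Q: if d <= 3e, the loss d^2 / 3 is at most e d and the next value does not exceed Q.
   Otherwise d - d^2 / 3 >= 2d / 3 > 2e, so the next value is below 1 - e. *)
have [le3|gt3] := leP (1 - Q) (3 * e).
  have : (1 - Q) * (1 - Q) <= (3 * e) * (1 - Q).
    by apply: ler_wpM2r => //; have := hits_lt1 (m + n0); rewrite -/(q _) -/Q; lra.
  by lra.
have : 0 <= Q * (1 - Q).
  by apply: mulr_ge0 => //; have := hits_lt1 (m + n0); rewrite -/(q _) -/Q; lra.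
by nra.
Qed.

End one_sided.

(** * Local finiteness of the positions *)

Section unbounded.
Context {R : realType} {d : measure_display} {T : measurableType d}.
Variables (P : probability T R) (X V : int -> T -> R).
Local Notation gap := (increment X).
Local Notation family := (increments_speeds X V).

Hypothesis mX : forall k, measurable_fun setT (X k).
Hypothesis mV : forall k, measurable_fun setT (V k).
Hypothesis indep : mutually_independent P family.
Hypothesis law_gap : forall k B, measurable B -> P (gap k @^-1` B) = P (gap 0 @^-1` B).
Hypothesis gap_pos : {ae P, forall w, 0 < gap 0 w}.
Hypothesis gap_ge1 : (0 < P (gap 0%R @^-1` `[1%R, +oo[))%E.

Lemma expr_le_eq0 (a c : R) : 0 <= a -> 0 <= c < 1 -> (forall n, a <= c ^+ n) -> a = 0.
Proof.
move=> a0 /andP[c0 c1] H; apply/eqP; rewrite eq_le a0 andbT leNgt; apply/negP => a_gt0.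
have c_lt1 : `|c| < 1 by rewrite ger0_norm.
have /cvgrPdist_lt /(_ a a_gt0)[N _ /(_ N (leqnn N))] := cvg_expr c_lt1.
rewrite sub0r normrN ger0_norm ?exprn_ge0// => lt_a.
by have := lt_le_trans lt_a (H N); rewrite ltxx.
Qed.

(** By independence [n] consecutive gaps are all below 1 with probability [c ^+ n], where
    [c < 1]. *)
Lemma large_gap_ae (m : nat) : {ae P, forall w, exists k : nat, (m <= k)%N /\ 1 <= gap k%:Z w}.
Proof.
pose small k : set T := gap k @^-1` `]-oo, 1[.
pose all_small n : set T := \bigcap_(k in [set k : nat | (m <= k < m + n)%N]) small k%:Z.
have mf := measurable_family mX mV.
have ms k : measurable (small k).
  by rewrite -[small k]setTI; apply: (mf (inl k)); [|exact: measurable_itv].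
have mall n : measurable (all_small n) by exact: bigcap_measurableType.
set c := fine (P (small 0)).
have smallE k : P (small k) = c%:E.
  by rewrite /small law_gap ?fineK ?fin_num_measure//.
have c1 : c < 1.
  have mge : measurable (gap 0 @^-1` `[1, +oo[).
    by rewrite -[_ @^-1` _]setTI; apply: (mf (inl 0)); [|exact: measurable_itv].
  have -> : c = 1 - fine (P (gap 0 @^-1` `[1, +oo[)).
    apply: EFin_inj; rewrite -(smallE 0) EFinB fineK ?fin_num_measure//.
    rewrite -probability_setC//; congr (P _); apply/seteqP.
    split=> w /=; rewrite !in_itv /= ?andbT; first by move=> lt; apply/negP; rewrite -ltNge.
    by move=> /negP; rewrite -ltNge.
  rewrite ltrBlDr ltrDl fine_gt0// gap_ge1/=.
  by rewrite (le_lt_trans (probability_le1 _ mge))// ltry.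
have c0 : 0 <= c by rewrite fine_ge0.
have key n : <<s rectangles family [set i | if i is inl k then k < (m + n)%N%:Z else False] >>
    (all_small n) /\ P (all_small n) = (c ^+ n)%:E.
  elim: n => [|n [sn Pn]].
    have -> : all_small 0 = setT.
      by apply/seteqP; split=> // w _ k /=; rewrite addn0 => /andP[mk /(leq_ltn_trans mk)]; rewrite ltnn.
    split; last by rewrite probability_setT.
    by apply: sub_sigma_algebra; exact: rectanglesT.
  have -> : all_small n.+1 = all_small n `&` small (m + n)%N%:Z.
    apply/seteqP; split=> w H.
      by split=> [k /= /andP[mk kn]|]; apply: H => /=; rewrite addnS; int_lia.
    move=> k /= /andP[mk]; rewrite addnS ltnS leq_eqVlt => /orP[/eqP ->|kn].
      by case: H.
    by case: H => H _; apply: H; rewrite /= mk.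
  have sm D : D (inl (m + n)%N%:Z) -> <<s rectangles family D >> (small (m + n)%N%:Z).
    move=> Dk; have := measurable_coordinate (X := family) Dk measurableT
      (measurable_itv `]-oo, (1 : R)[).
    by rewrite setTI.
  split.
    apply: sigma_rectanglesI; last by apply: sm; rewrite /=; int_lia.
    apply: sigma_rectanglesS sn => -[] //= k; int_lia.
  rewrite (sigma_rectangles_independent mf indep (D2 := [set inl (m + n)%N%:Z]) _ sn (sm _ erefl)).
    by rewrite Pn smallE -EFinM exprSr.
  by move=> i + /= E; rewrite E /= ltxx.
have mcap : measurable (\bigcap_n all_small n) by exact: bigcap_measurableType.
exists (\bigcap_n all_small n); split => //.
- rewrite -[P _]fineK ?fin_num_measure//; congr (_%:E).
  apply: (@expr_le_eq0 _ c); rewrite ?fine_ge0 ?c0//.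
  move=> n; have [_ Pn] := key n; rewrite -lee_fin -Pn fineK ?fin_num_measure//.
  by apply: le_measure; rewrite ?inE// => w; apply.
- move=> w /= nH n _ k /= /andP[mk _]; rewrite /small /= in_itv /= ltNge.
  by apply/negP => g1; apply: nH; exists k.
Qed.

Lemma unbounded_ae : {ae P, forall w, forall N : nat, exists n : nat, N%:R <= X n%:Z w - X 0 w}.
Proof.
have pos := gaps_pos_ae mX mV law_gap gap_pos.
have large : {ae P, forall w, forall m : nat, exists k : nat, (m <= k)%N /\ 1 <= gap k%:Z w}.
  by apply: ae_foralln => m; exact: large_gap_ae.
apply: filterS2 pos large => w g H; elim=> [|N [n IH]].
  by exists 0%N; rewrite subrr.
have [k [nk gk]] := H n; exists k.+1.
have nondec j : X n%:Z w <= X (n + j)%N%:Z w.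
  elim: j => [|j IHj]; first by rewrite addn0.
  apply: le_trans IHj _; have := g (n + j)%N%:Z; rewrite /increment.
  have -> : (n + j)%N%:Z + 1 = (n + j.+1)%N%:Z by int_lia.
  by rewrite subr_gt0 => /ltW.
have := nondec (k - n)%N; rewrite subnKC// => le_k.
move: gk; rewrite /increment; have -> : k%:Z + 1 = k.+1%:Z by int_lia.
by rewrite -natr1; lra.
Qed.

End unbounded.

(** * The two-sided system *)

Section two_sided.
Context {R : realType} {d : measure_display} {T : measurableType d}.
Variable P : probability T R.

(** What the two spacings share: independent, identically distributed, positive gaps with mass on
    both closed sides of 1. The class is stable under reflection, so one-sided results transfer to
    the left. *)
Record model (r1 r2 r3 : R) (X V : int -> T -> R) : Prop := Model {
  model_mX : forall k, measurable_fun setT (X k);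
  model_mV : forall k, measurable_fun setT (V k);
  model_indep : mutually_independent P (increments_speeds X V);
  model_speed : forall k, has_law P (V k) (uniform_on [:: r3; r2; r1]);
  model_gap : forall k B, measurable B ->
    P (increment X k @^-1` B) = P (increment X 0 @^-1` B);
  model_gap_pos : {ae P, forall w, 0 < increment X 0 w};
  model_gap_ge1 : (0 < P (increment X 0%R @^-1` `[1%R, +oo[))%E;
  model_gap_le1 : (0 < P (increment X 0%R @^-1` `]-oo, 1%R]))%E }.

Definition reflect (X : int -> T -> R) (k : int) (w : T) : R := - X (- k) w.

Lemma reflect_increment X k : increment (reflect X) k = increment X (- (k + 1)).
Proof.
apply/funext => w; rewrite /increment /reflect opprK addrC.
by have -> : - (k + 1) + 1 = - k by ring.
Qed.

Lemma model_reflect r1 r2 r3 X V :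
  model r1 r2 r3 X V -> model (- r3) (- r2) (- r1) (reflect X) (reflect V).
Proof.
move=> [mX mV ind sp gap pos ge1 le1].
have mN : measurable_fun setT (-%R : R -> R) by exact: oppr_measurable.
split.
- by move=> k; exact: (measurableT_comp mN (mX _)).
- by move=> k; exact: (measurableT_comp mN (mV _)).
- pose f (i : int + int) : int + int :=
    match i with inl k => inl (- (k + 1)) | inr k => inr (- k) end.
  apply: (@mutually_independent_image _ _ _ P _ _ (increments_speeds X V) _ f f
    (fun i => if i is inl _ then id else -%R)) ind.
  + by case=> k; rewrite /f; congr (_ _); ring.
  + by case=> k //; exact: measurable_id.
  + by case=> k w //=; rewrite reflect_increment.
- move=> k B mB.
  have mNB : measurable (-%R @^-1` B) by rewrite -[_ @^-1` _]setTI; exact: mN.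
  rewrite -[_ @^-1` B]/(V (- k) @^-1` (-%R @^-1` B)) [LHS]sp//.
  rewrite /uniform_on /= !big_cons !big_nil !adde0 !diracE.
  have E a : (a \in -%R @^-1` B) = (- a \in B) by apply/idP/idP; rewrite !inE.
  rewrite !E; congr (_ * _)%E.
  by rewrite -!EFinD; congr (_%:E); ring.
- by move=> k B mB; rewrite !reflect_increment gap// [RHS]gap.
- rewrite reflect_increment.
  by apply: filterS (gaps_pos_ae mX mV gap pos) => w; apply.
- by rewrite reflect_increment gap//; exact: measurable_itv.
- by rewrite reflect_increment gap//; exact: measurable_itv.
Qed.

Variables (r1 r2 r3 : R) (X V : int -> T -> R).
Hypotheses (hr32 : r3 < r2) (hr21 : r2 < r1) (mdl : model r1 r2 r3 X V).
Local Notation family := (increments_speeds X V).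

Definition surviving : set T := \bigcap_N \bigcup_n0 \bigcap_(n in [set n | (n0 <= n)%N])
  [set w | (N%:R%:E < central_time (X ^~ w) (V ^~ w) n 0%R)%E].

Lemma measurable_surviving : measurable surviving.
Proof.
case: mdl => mX mV _ _ _ _ _ _.
apply: bigcapT_measurable => N; apply: bigcupT_measurable => n0.
apply: bigcap_measurableType => n _.
rewrite -[X in measurable X]setTI; apply: measurable_lte => //.
apply: measurable_window_time; [by int_lia| |by move=> k _; exact: mV].
by move=> k _; exact: measurable_funB.
Qed.

Lemma regular_ae : {ae P, forall w, [/\ forall i j, i < j -> X i w < X j w,
  forall M, exists n : nat, forall i, `|X i w| <= M -> `|i| <= n%:Z
  & forall k, V k w \in [:: r3; r2; r1]]}.
Proof.
have mdl' := model_reflect mdl.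
case: mdl => mX mV ind sp gap pos ge1 le1.
case: mdl' => mX' mV' ind' sp' gap' pos' ge1' le1'.
have unb := unbounded_ae mX mV ind gap pos ge1.
have unb' := unbounded_ae mX' mV' ind' gap' pos' ge1'.
apply: filterS3 (good_ae hr32 hr21 mX mV sp gap pos) unb unb'.
move=> w [x_incr vin] right left; split=> // M.
have [n1 Hn1] := right (Num.truncn (M + `|X 0 w|)).+1.
have [n2 Hn2] := left (Num.truncn (M + `|X 0 w|)).+1.
have lt_M : M + `|X 0 w| < (Num.truncn (M + `|X 0 w|)).+1%:R by exact: truncnS_gt.
have := ler_norm (X 0 w); have := ler_norm (- X 0 w); rewrite normrN => x1 x2.
have nondec i j : i <= j -> X i w <= X j w.
  by rewrite le_eqVlt => /orP[/eqP ->//|/x_incr/ltW].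
exists (n1 + n2)%N => i; rewrite ler_norml => /andP[iM1 iM2].
have i1 : i <= n1%:Z.
  rewrite leNgt; apply/negP => /ltW/nondec; lra.
have i2 : - n2%:Z <= i.
  rewrite leNgt; apply/negP => /ltW/nondec.
  by move: Hn2; rewrite /reflect oppr0; lra.
by int_lia.
Qed.

Lemma surviving_ae : {ae P, forall w, surviving w <-> survives (X ^~ w) (V ^~ w) 0}.
Proof.
apply: filterS regular_ae => w [x_incr x_unb vin].
have v_bnd i : `|V i w| <= `|r1| + `|r2| + `|r3|.
  have := normr_ge0 r1; have := normr_ge0 r2; have := normr_ge0 r3.
  by case: (speedsP i vin) => ->; lra.
rewrite (survives_central x_incr x_unb v_bnd); split=> H N.
  by have [n0 _ Hn0] := H N I; exists n0 => n /Hn0.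
by move=> _; have [n0 Hn0] := H N; exists n0 => // n /= /Hn0.
Qed.

Local Notation missed n := (~` hits r2 X V 0 n).
Local Notation missed_left n := (~` hits (- r2) (reflect X) (reflect V) 0 n).

Lemma missed_surviving_ae : {ae P, forall w,
  V 0 w = r2 /\ (forall n, (missed n `&` missed_left n) w) -> surviving w}.
Proof.
apply: filterS2 regular_ae surviving_ae => w [x_incr x_unb vin] -> [v0 H].
have v_bnd i : `|V i w| <= `|r1| + `|r2| + `|r3|.
  have := normr_ge0 r1; have := normr_ge0 r2; have := normr_ge0 r3.
  by case: (speedsP i vin) => ->; lra.
apply: (survives_not_hit x_incr x_unb v_bnd v0) => n; apply/negP => hn.
  by have [] := H n; case; apply/hit_withinP; exists n.
by have [_] := H n; case; apply/hit_withinP; exists n.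
Qed.

(** The reflected gap [k >= 0] is the gap [-(k + 1) < 0], so this event shares no coordinate with
    its right-hand counterpart nor with the speed of 0. *)
Lemma sigma_missed_left n :
  <<s rectangles family [set i | match i with inl k => k < 0 | inr k => k < 0 end] >>
  (missed_left n).
Proof.
set D := (X in rectangles _ X).
have sH : <<s rectangles family D >> (hits (- r2) (reflect X) (reflect V) 0 n).
  apply: (sigma_event (f := fun w => hit_within (- r2) (reflect X ^~ w) (reflect V ^~ w) 0 n)).
  apply: (@measurable_hit_within _ _ (g_sigma_algebraType (rectangles family D))) => k k0.
    rewrite -[fun w => _]/(increment (reflect X) k) reflect_increment.
    by apply: (measurable_coordinate (X := family) (i := inl (- (k + 1)))); rewrite /D /=; int_lia.
  have mN : measurable_fun setT (-%R : R -> R) by exact: oppr_measurable.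
  have mVk : measurable_fun setT (V (- k) : g_sigma_algebraType (rectangles family D) -> R).
    by apply: (measurable_coordinate (X := family) (i := inr (- k))); rewrite /D /=; int_lia.
  exact: (measurableT_comp mN mVk).
exact: (@measurableC _ (g_sigma_algebraType (rectangles family D))).
Qed.

Lemma probability_missed n : P (speed V 0 r2 `&` missed n `&` missed_left n) =
  (P (speed V 0 r2) * P (missed n) * P (missed_left n))%E.
Proof.
case: mdl => mX mV ind sp gap pos ge1 le1.
have mf := measurable_family mX mV.
pose D0 : set (int + int) := [set inr 0].
have s0 : <<s rectangles family D0 >> (speed V 0 r2) by exact: sigma_speed.
have s1 : <<s rectangles family (after 0) >> (missed n).
  apply: (@measurableC _ (g_sigma_algebraType (rectangles family (after 0)))).
  exact: (@sigma_hits _ _ _ r2 X V 0 n).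
have s2 := sigma_missed_left n.
have s01 : <<s rectangles family (D0 `|` after 0) >> (speed V 0 r2 `&` missed n).
  by apply: sigma_rectanglesI; [apply: sigma_rectanglesS s0|apply: sigma_rectanglesS s1];
    move=> i Hi; [left|right].
rewrite (sigma_rectangles_independent mf ind _ s01 s2); last first.
  case=> k [E|a] l; rewrite /after /= in l; first by case: E.
  - by move: a; rewrite /after /=; int_lia.
  - by case: E => E; rewrite E ltxx in l.
  - by move: a; rewrite /after /=; int_lia.
congr (_ * _)%E; apply: (sigma_rectangles_independent mf ind _ s0 s1).
by move=> i /= ->.
Qed.

Lemma probability_surviving : (0 < P (surviving `&` speed V 0 r2))%E.
Proof.
have mdl' := model_reflect mdl.
case: (mdl) => mX mV ind sp gap pos ge1 le1.
case: (mdl') => mX' mV' ind' sp' gap' pos' ge1' le1'.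
have hr32' : - r1 < - r2 by rewrite ltrN2.
have hr21' : - r2 < - r3 by rewrite ltrN2.
have [e e0 He] := hits_bounded hr32 hr21 mX mV ind sp gap pos ge1 le1.
have [e' e'0 He'] := hits_bounded hr32' hr21' mX' mV' ind' sp' gap' pos' ge1' le1'.
pose C n := speed V 0 r2 `&` missed n `&` missed_left n.
have mS : measurable (speed V 0 r2) by exact: measurable_speed.
have mH n : measurable (hits r2 X V 0 n) by exact: measurable_hits.
have mH' n : measurable (hits (- r2) (reflect X) (reflect V) 0 n) by exact: measurable_hits.
have mC n : measurable (C n).
  by apply: measurableI; [apply: measurableI => //; exact: measurableC|exact: measurableC].
have ge_missed (A : set T) (b : R) : measurable A -> (P A <= (1 - b)%:E)%E -> (b%:E <= P (~` A))%E.
  move=> mA; rewrite probability_setC//.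
  rewrite -[P A]fineK ?fin_num_measure// -EFinB !lee_fin; lra.
(* One third for the speed of 0 and a uniform factor for each side; being free of [n], the bound
   passes to the decreasing intersection. *)
have geC n : ((3^-1 * e * e')%:E <= P (C n))%E.
  rewrite /C probability_missed (probability_speed hr32 hr21 sp) ?inE ?eqxx ?orbT//.
  have e3 : 0 <= 3^-1 * e by rewrite mulr_ge0 ?ltW// invr_gt0.
  rewrite EFinM; apply: lee_pmul; rewrite ?lee_fin ?(ltW e'0)//; last exact: ge_missed.
  rewrite EFinM; apply: lee_pmul; rewrite ?lee_fin ?(ltW e0) ?invr_ge0//.
  exact: ge_missed.
have mcap : measurable (\bigcap_n C n) by exact: bigcapT_measurable.
have cvg : (P \o C) n @[n --> \oo] --> P (\bigcap_n C n).
  apply: nonincreasing_cvg_mu => //.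
    by rewrite (le_lt_trans (probability_le1 _ (mC 0)))// ltry.
  move=> n m nm; apply/subsetPset => w [[v0 h] h']; split; first split=> //.
    by apply: contra_not h; exact: hit_within_le.
  by apply: contra_not h'; exact: hit_within_le.
have ge_cap : ((3^-1 * e * e')%:E <= P (\bigcap_n C n))%E.
  rewrite -(cvg_lim _ cvg)//; apply: lime_ge; first by apply/cvg_ex; eexists; exact: cvg.
  by apply: nearW => n; exact: geC.
apply: (@lt_le_trans _ _ (P (\bigcap_n C n))).
  by apply: lt_le_trans ge_cap; rewrite lte_fin !mulr_gt0// invr_gt0.
apply: le_probability_ae => //; first by apply: measurableI => //; exact: measurable_surviving.
apply: filterS missed_surviving_ae => w H HC.
have v0 : V 0 w = r2 by have [[]] := HC 0%N I.
by split=> //; apply: H; split=> // n; have [[_ ? ?]] := HC n I.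
Qed.

End two_sided.

(** * Unit and exponential spacings *)

Section spacings.
Context {R : realType} {d : measure_display} {T : measurableType d}.
Variables (P : probability T R) (x v : int -> {RV P >-> R}) (r1 r2 r3 : R).
Hypothesis hv : forall k, has_law P (v k) (uniform_on [:: r3; r2; r1]).
Hypothesis hindep : mutually_independent P (gaps_and_velocities x v).
Let X k : T -> R := x k.
Let V k : T -> R := v k.

Let measurable_gap k : measurable_fun setT (increment X k).
Proof. exact: measurable_funB. Qed.

Let indep : mutually_independent P (increments_speeds X V).
Proof. by have -> : increments_speeds X V = gaps_and_velocities x v by apply/funext => -[]. Qed.

Lemma model_unit : unit_spacings x -> model P r1 r2 r3 X V.
Proof.
move=> hx.
have gE k w : increment X k w = 1 by rewrite /increment /X !hx rmorphD /= addrAC subrr add0r.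
have pre k B : increment X k @^-1` B = increment X 0 @^-1` B.
  by apply/funext => w; rewrite /preimage /= !gE.
split=> //.
- by move=> k B _; rewrite pre.
- by apply: aeW => w; rewrite gE.
- rewrite (_ : _ @^-1` _ = setT) ?probability_setT//.
  by apply/seteqP; split=> w // _; rewrite /= gE in_itv /= lexx.
- rewrite (_ : _ @^-1` _ = setT) ?probability_setT//.
  by apply/seteqP; split=> w // _; rewrite /= gE in_itv /= lexx.
Qed.

Lemma model_exponential : exponential_spacings x -> model P r1 r2 r3 X V.
Proof.
move=> [_ hx].
have law k B : measurable B -> P (increment X k @^-1` B) = exponential_prob 1 B.
  exact: hx.
have m B : measurable B -> measurable (increment X 0 @^-1` B).
  by move=> mB; rewrite -[_ @^-1` _]setTI; exact: measurable_gap.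
have neg : P (increment X 0 @^-1` `]-oo, 0[) = 0%E.
  rewrite law// /exponential_prob; apply: integral0_eq => y.
  by rewrite /= in_itv /= => y0; rewrite lt0_exponential_pdf.
have pos y : 0 < y -> P (increment X 0 @^-1` `[0, y]) = (1 - expR (- y))%:E.
  by move=> y0; rewrite law// exponential_prob_itv0c// mulN1r EFinB.
have le (y : R) : 0 < y -> (P (increment X 0%R @^-1` `]-oo, y]) <= (1 - expR (- y))%:E)%E.
  move=> y0; rewrite -(pos y y0) -[leRHS]add0e -neg.
  have -> : increment X 0 @^-1` `]-oo, y] =
      increment X 0 @^-1` `]-oo, 0[ `|` increment X 0 @^-1` `[0, y].
    apply/seteqP; split=> w; rewrite /= !in_itv /=.
      by move=> wy; case: (ltP (increment X 0 w) 0) => w0; [left|right; rewrite wy].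
    by move=> [/ltW/le_trans|/andP[_ //]]; apply; exact: ltW.
  by apply: measureU2; exact: m.
split=> //.
- by move=> k B mB; rewrite !law.
(* A mass a > 0 on the half-line up to 0 would satisfy a <= 1 - exp(-a/2) <= a/2. *)
- exists (increment X 0 @^-1` `]-oo, 0]); split; first exact: m.
    have P0 : (P (increment X 0%R @^-1` `]-oo, 0%R]) \is a fin_num)%E.
      by rewrite fin_num_measure//; exact: m.
    rewrite -[P _]fineK//; congr (_%:E); apply/eqP; rewrite eq_le fine_ge0// andbT.
    rewrite leNgt; apply/negP => a0.
    set a := fine _ in a0; have a2 : 0 < a / 2 by rewrite divr_gt0.
    have : a <= 1 - expR (- (a / 2)).
      rewrite -lee_fin fineK//; apply: le_trans (le _ a2).
      apply: le_measure; rewrite ?inE; [exact: m|exact: m|].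
      by move=> w; rewrite /= !in_itv /= => /le_trans; apply; exact: ltW.
    by have := expR_ge1Dx (- (a / 2)); lra.
  by move=> w /= /negP; rewrite -leNgt in_itv.
- have -> : increment X 0 @^-1` `[1, +oo[ = ~` (increment X 0 @^-1` `]-oo, 1[).
    apply/seteqP; split=> w; rewrite /= !in_itv /= andbT; first by rewrite leNgt => /negP.
    by move=> /negP; rewrite -leNgt.
  have m1 : measurable (increment X 0 @^-1` `]-oo, 1[) by exact: m.
  rewrite probability_setC// -[P _]fineK ?fin_num_measure// -EFinB lte_fin subr_gt0.
  have : (P (increment X 0%R @^-1` `]-oo, 1%R[) <= (1 - expR (- 1))%:E)%E.
    apply: le_trans (le 1 ltr01); apply: le_measure; rewrite ?inE//; first exact: m.
    by move=> w; rewrite /= !in_itv /= => /ltW.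
  rewrite -[P _]fineK ?fin_num_measure// lee_fin.
  by have := expR_gt0 (- 1 : R); lra.
- apply: (@lt_le_trans _ _ (P (increment X 0 @^-1` `[0, 1]))).
    by rewrite pos// lte_fin subr_gt0 expR_lt1 oppr_lt0.
  apply: le_measure; rewrite ?inE; [exact: m|exact: m|].
  by move=> w; rewrite /= !in_itv /= => /andP[].
Qed.

End spacings.

Theorem corollary3 (R : realType) (d : measure_display) (T : measurableType d)
    (P : probability T R) (r1 r2 r3 : R) (x v : int -> {RV P >-> R})
    (hr32 : r3 < r2) (hr21 : r2 < r1)
    (hx : unit_spacings x \/ exponential_spacings x)
    (hv : forall k, has_law P (v k) (uniform_on [:: r3; r2; r1]))
    (hindep : mutually_independent P (gaps_and_velocities x v)) :
  exists S : set T,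
    [/\ measurable S,
        {ae P, forall w, S w <-> survives (x ^~ w) (v ^~ w) 0}
      & 0 < cond_prob P S (v 0 @^-1` [set r2])].
Proof.
have mdl : model P r1 r2 r3 (fun k => x k : T -> R) (fun k => v k : T -> R).
  by case: hx => hx; [exact: model_unit|exact: model_exponential].
exists (surviving (fun k => x k : T -> R) (fun k => v k : T -> R)); split.
- exact: measurable_surviving mdl.
- exact: surviving_ae hr32 hr21 mdl.
rewrite /cond_prob; have ps := probability_surviving hr32 hr21 mdl.
have mS := measurable_surviving mdl.
have mv : measurable (v 0 @^-1` [set r2]) by rewrite -[_ @^-1` _]setTI; exact: measurable_funPT.
have lt_oo (A : set T) : measurable A -> (P A < +oo)%E.
  by move=> mA; rewrite (le_lt_trans (probability_le1 _ mA))// ltry.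
have mI := measurableI _ _ mS mv.
rewrite divr_gt0// fine_gt0// lt_oo// andbT//.
by apply: lt_le_trans ps _; apply: le_measure; rewrite ?inE//; exact: subIsetr.
Qed.
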